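(* Consider the simultaneous block-fading binary symmetric wiretap channel with parameters $q_1\in[0,1]$, $q_2=1-q_1$, and crossover probabilities satisfying $p_1\le p_2\le p_1^*\le p_2^*\le 0.5$. Its secrecy capacity with channel state information available only at the decoders is $$C^s_{\textrm{CSI-D}}= q_1[H(p_1^* )-H(p_1)]+q_2[H(p_2^* )-H(p_2)].$$
   Context: $H(p)=-p\log_2 p-(1-p)\log_2(1-p)$ is the binary entropy function, and BSC$(p)$ denotes the binary symmetric channel with crossover probability $p$. Simultaneous block-fading binary symmetric wiretap channel: the transmitter sends $NB$ binary symbols $X_{1:NB}$ organized in $B$ fading blocks of length $N$. Each block $k$ has a fading state $S_k\in\{1,2\}$, constant within the block, with $\Pr(S_k=1)=q_1$, $\Pr(S_k=2)=q_2$, states independent across blocks. Within block $k$, the legitimate receiver observes the output $Y$ of $N$ independent uses of BSC$(p_{S_k})$, and the eavesdropper observes the output $Z$ of $N$ independent uses of BSC$(p^*_{S_k})$ (same state for both). Let $\mathsf{S}=(S_1,\dots,S_B)$. A code consists of a (possibly randomized) encoder $X_{1:NB}=f(\mathsf{M})$ of a uniformly distributed message $\mathsf{M}$, which knows only the state distribution (not the realizations), and a decoder $\hat{\mathsf{M}}=g(Y_{1:NB},\mathsf{S})$ that knows the states; its rate is $\frac{1}{NB}\log_2$ of the message-set size. A rate $R$ is achievable if there are such codes of rate at least $R$ (asymptotically) with $N,B\to\infty$ such that $\Pr\{\mathsf{M}\ne\hat{\mathsf{M}}\}\to0$ and $\frac{1}{NB}I(\mathsf{M};Z_{1:NB}\mid\mathsf{S})\to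 0$. $C^s_{\textrm{CSI-D}}$ is the supremum of achievable rates. *)

(* Defs.v *)
From HB Require Import structures.
From mathcomp Require Import all_boot all_order all_algebra.
From mathcomp Require Import all_classical all_reals all_analysis.
Unset Printing Implicit Defensive.
Import Order.TTheory GRing.Theory Num.Theory.
Import numFieldNormedType.Exports.
Local Open Scope classical_set_scope.
Local Open Scope ring_scope.

Section BFWT.
Context {R : realType}.

Definition log2 (x : R) : R := ln x / ln 2.

Definition xlog2x (x : R) : R := if x == 0 then 0 else x * log2 x.

Definition Hb (p : R) : R := - xlog2x p - xlog2x (1 - p).

Definition mutual_info {A B : finType} (P : A -> B -> R) : R :=
  \sum_(a : A) \sum_(b : B)
    (if P a b == 0 then 0
     else P a b * log2 (P a b / ((\sum_(b' : B) P a b') * (\sum_(a' : A) P a' b)))).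

(* Fading states: 'I_2, ord0 = state 1, the other = state 2. *)
Definition sel (a b : R) (s : 'I_2) : R := if s == ord0 then a else b.

(* A channel input/output word: NB binary symbols, organised as B blocks of length N.
   Position (k, j) is symbol j of block k. *)
Definition word (N B : nat) := {ffun 'I_B * 'I_N -> bool}.
Definition states (B : nat) := {ffun 'I_B -> 'I_2}.

Definition Pstate (q1 : R) {B : nat} (s : states B) : R :=
  \prod_(k : 'I_B) sel q1 (1 - q1) (s k).

Definition bsc (p : R) (x y : bool) : R := if x == y then 1 - p else p.

Definition chan (pa pb : R) {N B : nat} (s : states B) (x y : word N B) : R :=
  \prod_(i : 'I_B * 'I_N) bsc (sel pa pb (s i.1)) (x i) (y i).

Record code (N B : nat) := Code {
  csize : nat;
  csize_gt0 : (0 < csize)%N;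
  cenc : 'I_csize -> word N B -> R;
  cenc_ge0 : forall m x, 0 <= cenc m x;
  cenc_sum1 : forall m, \sum_(x : word N B) cenc m x = 1;
  cdec : states B -> word N B -> 'I_csize }.
Arguments csize {N B} c.
Arguments csize_gt0 {N B} c.
Arguments cenc {N B} c m x.
Arguments cenc_ge0 {N B} c m x.
Arguments cenc_sum1 {N B} c m.
Arguments cdec {N B} c s y.

Definition Pout (pa pb : R) {N B} (C : code N B) (s : states B) (m : 'I_(csize C))
  (y : word N B) : R :=
  \sum_(x : word N B) cenc C m x * chan pa pb s x y.

Definition perr (q1 p1 p2 : R) {N B} (C : code N B) : R :=
  \sum_(s : states B) Pstate q1 s *
    \sum_(m : 'I_(csize C)) (csize C)%:R^-1 *
      \sum_(y : word N B) Pout p1 p2 C s m y * (cdec C s y != m)%:R.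

Definition leak (q1 ps1 ps2 : R) {N B} (C : code N B) : R :=
  \sum_(s : states B) Pstate q1 s *
    mutual_info (fun (m : 'I_(csize C)) (z : word N B) =>
                   (csize C)%:R^-1 * Pout ps1 ps2 C s m z).

Definition rate {N B} (C : code N B) : R := log2 (csize C)%:R / (N * B)%:R.

Definition achievable (q1 p1 p2 ps1 ps2 : R) (r : R) : Prop :=
  exists (N B : nat -> nat) (C : forall t, code (N t) (B t)),
    (forall K : nat, \forall t \near \oo, (K <= N t)%N /\ (K <= B t)%N) /\
    (forall eps : R, 0 < eps -> \forall t \near \oo, r - eps <= rate (C t)) /\
    ((fun t => perr q1 p1 p2 (C t)) @ \oo --> (0 : R)) /\
    ((fun t => leak q1 ps1 ps2 (C t) / (N t * B t)%:R) @ \oo --> (0 : R)).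

Definition secrecy_capacity_CSID (q1 p1 p2 ps1 ps2 : R) : \bar R :=
  ereal_sup [set r%:E | r in [set r | achievable q1 p1 p2 ps1 ps2 r]].

End BFWT.

(* Main.v *)
Require Import Defs.
From HB Require Import structures.
From mathcomp Require Import all_boot all_order all_algebra.
From mathcomp Require Import all_classical all_reals all_analysis.
From mathcomp Require Import ring lra.
Import Order.TTheory GRing.Theory Num.Theory.
Import numFieldNormedType.Exports.
Local Open Scope classical_set_scope.
Local Open Scope ring_scope.

(** Converse: the eavesdropper's channel is a degraded version of the legitimate
    one by a doubly stochastic channel, in every state. Writing [M - X - Y - Z],
    [I(M;Y) - I(M;Z)] is the sum of [H(Y) - H(Z) <= 0] and [H(Z|M) - H(Y|M)], and
    the latter is at most [H(Z|X) - H(Y|X)] because [I(X;Z|M) <= I(X;Y|M)]. No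
    single-letterization is needed: [H(Z|X) - H(Y|X)] depends on the state only.
    Fano's inequality and an average over the states conclude.

    Achievability: uniform random codewords [x(m, l)], where [l] is a uniform dummy
    message, are decoded by thresholding the likelihood [chan s x y]. The
    legitimate receiver decodes [(m, l)]; the eavesdropper, if given [m], decodes
    [l]. Hence [I(M;Z) = I(M,L;Z) - I(L;Z|M)] is at most the capacity of the
    eavesdropper's channel minus, by Fano, about the rate of [l], which is chosen
    close to that capacity. The law of large numbers for the likelihood comes from
    Chebyshev's inequality, applied to the noise and to the fading states. *)

(** * Entropy and mutual information of finite channels *)

Section Information.
Context {R : realType}.
Implicit Types (a b p w x : R).

Lemma ln2_gt0 : 0 < ln 2 :> R.
Proof. by rewrite ln_gt0 // ltr1n. Qed.

Lemma log2M x y : 0 < x -> 0 < y -> log2 (x * y) = log2 x + log2 y :> R.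
Proof. by move=> x0 y0; rewrite /log2 lnM // mulrDl. Qed.

Lemma log2V x : 0 < x -> log2 x^-1 = - log2 x :> R.
Proof. by move=> x0; rewrite /log2 lnV // mulNr. Qed.

Lemma log2_pow2 x : log2 (2 `^ x) = x :> R.
Proof. by rewrite /log2 ln_powR mulfK // gt_eqF ?ln2_gt0. Qed.

Lemma log2_2 : log2 2 = 1 :> R.
Proof. by rewrite /log2 divff // gt_eqF ?ln2_gt0. Qed.

Lemma log2_1 : log2 1 = 0 :> R.
Proof. by rewrite /log2 ln1 mul0r. Qed.

Lemma ler_log2 x y : 0 < x -> x <= y -> log2 x <= log2 y :> R.
Proof.
move=> x0 xy; rewrite ler_pM2r ?invr_gt0 ?ln2_gt0 // ler_ln //.
exact: lt_le_trans xy.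
Qed.

Lemma ltr_log2 x y : 0 < x -> x < y -> log2 x < log2 y :> R.
Proof.
move=> x0 xy; rewrite ltr_pM2r ?invr_gt0 ?ln2_gt0 // ltr_ln //.
exact: lt_trans xy.
Qed.

Lemma xlog2xE x : xlog2x x = x * log2 x.
Proof. by rewrite /xlog2x; case: eqP => // ->; rewrite mul0r. Qed.

Lemma sum_ge0_eq0 {I : finType} {F : I -> R} :
  (forall i, 0 <= F i) -> \sum_i F i = 0 -> forall i, F i = 0.
Proof. by move=> F0 S0 i; apply: (psumr_eq0P _ S0). Qed.

(* The tangent of [ln] at [1]; every information inequality below is an instance. *)
Lemma log2_tangent a b w : 0 <= a -> 0 <= b -> (b = 0 -> a = 0) -> 0 < w ->
  a * log2 w + (a - b * w) / ln 2 <= a * (log2 a - log2 b).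
Proof.
move=> a0 b0 ba w0; have l2 := ln2_gt0.
have [->|an0] := eqVneq a 0.
  by rewrite !mul0r !add0r mulNr oppr_le0 divr_ge0 ?mulr_ge0 // ltW.
have {an0}a0 : 0 < a by rewrite lt_def an0.
have {}b0 : 0 < b.
  by rewrite lt_def b0 andbT; apply: contra_neq (lt0r_neq0 a0) => /ba.
have u0 : 0 < b * w / a by rewrite divr_gt0 ?mulr_gt0.
have : ln (b * w / a) <= b * w / a - 1.
  by rewrite -{1}[b * w / a](addrNK 1) [X in ln X]addrC le_ln1Dx // ltrBrDl subrr.
rewrite lnM ?posrE ?mulr_gt0 ?invr_gt0 // lnM ?posrE // lnV ?posrE // => h.
have {}h : a * (ln b + ln w - ln a) <= b * w - a.
  have := ler_wpM2l (ltW a0) h; rewrite [a * (_ - 1)]mulrBr mulr1.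
  by rewrite [a * (_ / a)]mulrC divfK ?gt_eqF.
rewrite /log2 mulrA -mulrDl -mulrBl mulrA ler_pM2r ?invr_gt0 //.
nra.
Qed.

(** Sums the tangent inequality at [w], the ratio of the two weighted totals, for which the linear
    corrections cancel. *)
Lemma log_sum {Y : finType} (T a b : Y -> R) :
  (forall y, 0 <= T y) -> (forall y, 0 <= a y) -> (forall y, 0 <= b y) ->
  (forall y, b y = 0 -> a y = 0) ->
  (\sum_y T y * a y) * (log2 (\sum_y T y * a y) - log2 (\sum_y T y * b y)) <=
  \sum_y T y * (a y * (log2 (a y) - log2 (b y))).
Proof.
move=> T0 a0 b0 ba.
set A := \sum_y T y * a y; set B := \sum_y T y * b y.
have Ta0 y : 0 <= T y * a y by rewrite mulr_ge0.
have Tb0 y : 0 <= T y * b y by rewrite mulr_ge0.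
have A0 : 0 <= A by rewrite sumr_ge0.
have B0 : 0 <= B by rewrite sumr_ge0.
have [Az|An0] := eqVneq A 0.
  rewrite Az mul0r big1 // => y _; rewrite mulrA.
  by rewrite (sum_ge0_eq0 Ta0 Az) ?mul0r.
have Ap : 0 < A by rewrite lt_def An0.
have Bp : 0 < B.
  rewrite lt_def B0 andbT; apply: contra_neq An0 => Bz.
  rewrite /A big1 // => y _.
  have /eqP := sum_ge0_eq0 Tb0 Bz y.
  by rewrite mulf_eq0 => /orP[/eqP->|/eqP/ba->]; rewrite ?mul0r ?mulr0.
pose w := A / B.
have w0 : 0 < w by rewrite divr_gt0.
have -> : A * (log2 A - log2 B) =
    \sum_y T y * (a y * log2 w + (a y - b y * w) / ln 2).
  rewrite (eq_bigr (fun y => T y * a y * log2 w +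
      (T y * a y - T y * b y * w) / ln 2)); last by move=> y _; ring.
  rewrite big_split /= -mulr_suml -/A -mulr_suml sumrB -mulr_suml -/A -/B.
  rewrite /w [B * _]mulrC divfK ?gt_eqF // subrr mul0r addr0.
  by rewrite log2M ?invr_gt0 // log2V.
apply: ler_sum => y _; apply: ler_wpM2l => //.
by apply: log2_tangent => //; exact: ba.
Qed.

Definition ent {Y : finType} (P : Y -> R) : R := - \sum_y xlog2x (P y).

Definition mix {U Y : finType} (k : U -> R) (V : U -> Y -> R) (y : Y) : R :=
  \sum_u k u * V u y.

(* The mutual information between [u], drawn with law [k], and the output of
   the channel [V] on input [u]. *)
Definition info {U Y : finType} (k : U -> R) (V : U -> Y -> R) : R :=
  ent (mix k V) - \sum_u k u * ent (V u).

Definition pushes {Y Z : finType} (T : Y -> Z -> R) (P : Y -> R) (z : Z) : R :=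
  \sum_y T y z * P y.

(** The average Kullback-Leibler divergence from the mixture: in this form the log-sum inequality
    applies separately for each [u]. *)
Lemma info_kl {U Y : finType} (k : U -> R) (V : U -> Y -> R) : info k V =
  \sum_u k u * \sum_y V u y * (log2 (V u y) - log2 (mix k V y)).
Proof.
rewrite /info /ent addrC.
rewrite [RHS](eq_bigr (fun u => \sum_y k u * (V u y * log2 (V u y)) -
   \sum_y k u * V u y * log2 (mix k V y))); last first.
  move=> u _; rewrite -sumrB mulr_sumr; apply: eq_bigr => y _; ring.
rewrite sumrB; congr (_ - _).
  rewrite -sumrN; apply: eq_bigr => u _; rewrite mulrN opprK mulr_sumr.
  by apply: eq_bigr => y _; rewrite xlog2xE.
rewrite exchange_big /=; apply: eq_bigr => y _.
by rewrite -mulr_suml xlog2xE.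
Qed.

Section Finite.
Context {U Y Z : finType}.
Implicit Types (k : U -> R) (V : U -> Y -> R) (T : Y -> Z -> R).

Lemma mix_ge0 k V y : (forall u, 0 <= k u) -> (forall u y, 0 <= V u y) ->
  0 <= mix k V y.
Proof. by move=> k0 V0; apply: sumr_ge0 => u _; rewrite mulr_ge0. Qed.

Lemma mix_eq0 k V u y : (forall u, 0 <= k u) -> (forall u y, 0 <= V u y) ->
  0 < k u -> mix k V y = 0 -> V u y = 0.
Proof.
move=> k0 V0 ku m0; have kV0 v : 0 <= k v * V v y by rewrite mulr_ge0.
by have /eqP := sum_ge0_eq0 kV0 m0 u; rewrite mulf_eq0 gt_eqF //= => /eqP.
Qed.

Lemma pushes_mix k V T : pushes T (mix k V) =1 mix k (fun u => pushes T (V u)).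
Proof.
move=> z; rewrite /pushes /mix.
under eq_bigr do rewrite mulr_sumr.
rewrite exchange_big; apply: eq_bigr => u _; rewrite mulr_sumr.
by apply: eq_bigr => y _; ring.
Qed.

(** For each [u] and each output [z], the log-sum inequality with weights [T y z] contracts the
    divergence of [V u] from the mixture. *)
Lemma info_data_processing k V T :
  (forall u, 0 <= k u) -> (forall u y, 0 <= V u y) ->
  (forall y z, 0 <= T y z) -> (forall y, \sum_z T y z = 1) ->
  info k (fun u => pushes T (V u)) <= info k V.
Proof.
move=> k0 V0 T0 T1; rewrite !info_kl.
apply: ler_sum => u _.
(* Where [k u] vanishes the mixture need not dominate [V u], so this case is set aside. *)
have [->|kn0] := eqVneq (k u) 0; first by rewrite !mul0r.
have ku : 0 < k u by rewrite lt_def kn0 k0.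
rewrite ler_pM2l //.
have -> : \sum_y V u y * (log2 (V u y) - log2 (mix k V y)) =
  \sum_z \sum_y T y z * (V u y * (log2 (V u y) - log2 (mix k V y))).
  by rewrite exchange_big; apply: eq_bigr => y _; rewrite -mulr_suml T1 mul1r.
apply: ler_sum => z _; rewrite -pushes_mix.
apply: log_sum => // y; first exact: mix_ge0.
exact: mix_eq0.
Qed.

End Finite.

Lemma info_ge0 {U Y : finType} (k : U -> R) (V : U -> Y -> R) :
  (forall u, 0 <= k u) -> (forall u y, 0 <= V u y) ->
  (forall u, \sum_y V u y = 1) -> \sum_u k u = 1 -> 0 <= info k V.
Proof.
move=> k0 V0 V1 k1; rewrite info_kl; apply: sumr_ge0 => u _.
have [->|kn0] := eqVneq (k u) 0; first by rewrite mul0r.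
have ku : 0 < k u by rewrite lt_def kn0 k0.
apply: mulr_ge0 => //.
have := @log_sum Y (fun=> 1) (V u) (mix k V) (fun=> ler01) (V0 u)
  (fun y => mix_ge0 _ _ y k0 V0) (fun y => mix_eq0 _ _ u y k0 V0 ku).
under eq_bigr do rewrite mul1r.
have -> : \sum_y 1 * mix k V y = 1.
  under eq_bigr do rewrite mul1r.
  rewrite exchange_big -[RHS]k1; apply: eq_bigr => v _.
  by rewrite -mulr_sumr V1 mulr1.
rewrite V1 subrr mulr0; under eq_bigr do rewrite mul1r.
by [].
Qed.

Lemma eq_ent {Y : finType} (P Q : Y -> R) : P =1 Q -> ent P = ent Q.
Proof. by move=> PQ; rewrite /ent; congr (- _); apply: eq_bigr => y _; rewrite PQ. Qed.

(** Log-sum against the constant 1: since the weights [T y z] sum to 1 over [y], the reference total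
    is 1 and its logarithm vanishes. *)
Lemma ent_doubly_stochastic {Y Z : finType} (T : Y -> Z -> R) (P : Y -> R) :
  (forall y z, 0 <= T y z) -> (forall y, \sum_z T y z = 1) ->
  (forall z, \sum_y T y z = 1) -> (forall y, 0 <= P y) ->
  ent P <= ent (pushes T P).
Proof.
move=> T0 T1 T1' P0; rewrite lerN2.
have -> : \sum_y xlog2x (P y) =
    \sum_z \sum_y T y z * (P y * (log2 (P y) - log2 1)).
  rewrite exchange_big; apply: eq_bigr => y _.
  by rewrite -mulr_suml T1 mul1r log2_1 subr0 xlog2xE.
apply: ler_sum => z _; rewrite xlog2xE.
have := @log_sum Y (T^~ z) P (fun=> 1) (T0^~ z) P0 (fun=> ler01).
under [X in _ - log2 X]eq_bigr do rewrite mulr1.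
rewrite T1' log2_1 subr0; apply=> y /eqP; by rewrite oner_eq0.
Qed.

Lemma ent_le_log_card {Y : finType} (P : Y -> R) :
  (forall y, 0 <= P y) -> \sum_y P y = 1 -> ent P <= log2 #|Y|%:R.
Proof.
move=> P0 P1.
have := @log_sum Y (fun=> 1) P (fun=> 1) (fun=> ler01) P0 (fun=> ler01).
have -> : \sum_y 1 * P y = 1 by rewrite -mulr_sumr P1 mulr1.
have -> : \sum_(y : Y) 1 * 1 = #|Y|%:R :> R by rewrite sumr_const mulr1.
have -> : \sum_y 1 * (P y * (log2 (P y) - log2 1)) = \sum_y xlog2x (P y).
  by apply: eq_bigr => y _; rewrite mul1r log2_1 subr0 xlog2xE.
rewrite log2_1 mul1r sub0r /ent lerNl; apply=> y /eqP.
by rewrite oner_eq0.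
Qed.

(* Fano's inequality, by comparing the joint law of [(u, y)] with the product
   law reweighted by [#|U| / 2] where [dec y = u] and by [1 / 2] elsewhere. *)
Lemma fano {U Y : finType} (V : U -> Y -> R) (dec : Y -> U) :
  (0 < #|U|)%N -> (forall u y, 0 <= V u y) -> (forall u, \sum_y V u y = 1) ->
  (\sum_u #|U|%:R^-1 * \sum_y V u y * (dec y == u)%:R) * log2 #|U|%:R - 1
    <= info (fun=> #|U|%:R^-1) V.
Proof.
move=> U0 V0 V1; set L : R := #|U|%:R; set k : U -> R := fun=> _.
have L0 : 0 < L by rewrite ltr0n.
have k0 u : 0 < k u by rewrite invr_gt0.
have k0' u : 0 <= k u by exact: ltW.
have sk : \sum_u k u = 1.
  by rewrite sumr_const -mulr_natl mulfV // gt_eqF.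
pose e u y : R := (dec y == u)%:R.
rewrite -[X in X * _]/(\sum_u k u * \sum_y V u y * e u y).
have kL u : k u = L^-1 by [].
clearbody k.
pose w u y : R := if dec y == u then L / 2 else 2^-1.
have w0 u y : 0 < w u y by rewrite /w; case: ifP; rewrite ?divr_gt0 ?invr_gt0.
rewrite info_kl.
apply: (@le_trans _ _ (\sum_u k u * \sum_y (V u y * log2 (w u y) +
   (V u y - mix k V y * w u y) / ln 2))); last first.
  apply: ler_sum => u _; apply: ler_wpM2l => //; apply: ler_sum => y _.
  apply: log2_tangent => //; first exact: mix_ge0.
  exact: mix_eq0.
have -> : \sum_u k u * \sum_y (V u y * log2 (w u y) +
   (V u y - mix k V y * w u y) / ln 2) =
   (\sum_u k u * \sum_y V u y * log2 (w u y)) +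
   ((\sum_u k u * \sum_y V u y) - \sum_u k u * \sum_y mix k V y * w u y) / ln 2.
  rewrite -sumrB mulr_suml -big_split; apply: eq_bigr => u _ /=.
  rewrite big_split /= -mulr_suml sumrB; field.
  exact: lt0r_neq0 ln2_gt0.
have -> : \sum_u k u * \sum_y V u y * log2 (w u y) =
  (\sum_u k u * \sum_y V u y * e u y) * log2 L - 1.
  rewrite -[X in _ - X]sk mulr_suml -sumrB; apply: eq_bigr => u _.
  rewrite -mulrA -[X in _ - X]mulr1 -mulrBr; congr (_ * _).
  rewrite -(V1 u) mulr_suml -sumrB; apply: eq_bigr => y _.
  rewrite /w /e; case: ifP => _ /=; last by rewrite log2V // log2_2; ring.
  by rewrite log2M ?invr_gt0 // log2V // log2_2; ring.
(* The linear correction is nonnegative because the reweighted product law has mass at most 1: for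
   each [y], the weights sum to at most [L / 2 + L / 2]. *)
rewrite lerDl divr_ge0 ?ln2_gt0 ?(ltW ln2_gt0) // subr_ge0.
have -> : \sum_u k u * \sum_y V u y = 1.
  by rewrite -sk; apply: eq_bigr => u _; rewrite V1 mulr1.
have <- : \sum_y mix k V y = 1.
  rewrite exchange_big -sk; apply: eq_bigr => u _.
  by rewrite -mulr_sumr V1 mulr1.
under eq_bigr do rewrite mulr_sumr.
rewrite exchange_big /=; apply: ler_sum => y _.
under eq_bigr do rewrite mulrCA.
rewrite -mulr_sumr ler_piMr ?mix_ge0 //.
rewrite (eq_bigr (fun u => w u y / L)); last by move=> u _; rewrite kL mulrC.
rewrite -mulr_suml ler_pdivrMr // mul1r.
rewrite (bigD1 (dec y)) //= {1}/w eqxx.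
rewrite (eq_bigr (fun=> 2^-1)); last first.
  by move=> u /negPf; rewrite eq_sym /w => ->.
have : \sum_(u | u != dec y) 2^-1 <= \sum_(u : U) (2^-1 : R).
  by rewrite [leRHS](bigD1 (dec y)) //= lerDr invr_ge0.
by rewrite [X in _ <= X -> _]sumr_const -[X in _ <= X -> _]mulr_natl -/L; lra.
Qed.

(** Where the joint probability is 0 both summands vanish; elsewhere all factors are positive and
    the logarithm of the ratio splits. *)
Lemma mutual_infoE {U Y : finType} (k : U -> R) (V : U -> Y -> R) :
  (forall u, 0 <= k u) -> (forall u y, 0 <= V u y) ->
  (forall u, \sum_y V u y = 1) ->
  mutual_info (fun u y => k u * V u y) = info k V.
Proof.
move=> k0 V0 V1; rewrite info_kl /mutual_info; apply: eq_bigr => u _.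
rewrite mulr_sumr; apply: eq_bigr => y _.
rewrite -mulr_sumr V1 mulr1 -/(mix k V y) mulrA.
case: eqP => [->|/eqP]; first by rewrite mul0r.
rewrite mulf_eq0 negb_or => /andP[kn0 Vn0].
have kp : 0 < k u by rewrite lt_def kn0 k0.
have Vp : 0 < V u y by rewrite lt_def Vn0 V0.
have mp : 0 < mix k V y.
  rewrite lt_def mix_ge0 // andbT; apply: contra_neq Vn0; exact: mix_eq0.
congr (_ * _); rewrite invfM mulrACA mulfV ?gt_eqF // mul1r.
by rewrite log2M ?invr_gt0 // log2V.
Qed.

End Information.

(** * Product laws and binary symmetric channels *)

Section Product.
Context {R : realType} {I A : finType}.
Implicit Types (P G : I -> A -> R) (f : {ffun I -> A}).

Definition prodm P f : R := \prod_i P i (f i).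

Lemma prodm_ge0 P f : (forall i a, 0 <= P i a) -> 0 <= prodm P f.
Proof. by move=> P0; apply: prodr_ge0. Qed.

Lemma prodm_expect_prod P G :
  \sum_f prodm P f * \prod_i G i (f i) = \prod_i \sum_a P i a * G i a.
Proof.
rewrite bigA_distr_bigA; apply: eq_bigr => f _.
by rewrite -big_split.
Qed.

Lemma prodm_sum P : \sum_f prodm P f = \prod_i \sum_a P i a.
Proof. by rewrite bigA_distr_bigA. Qed.

Lemma prodm_sum1 P : (forall i, \sum_a P i a = 1) -> \sum_f prodm P f = 1.
Proof. by move=> P1; rewrite prodm_sum big1. Qed.

(** Turns a function of one coordinate into a product over all of them, so that marginals follow
    from [prodm_expect_prod]. *)
Lemma prod_at (i : I) (g : A -> R) f : g (f i) = \prod_l (if l == i then g (f l) else 1).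
Proof. by rewrite -big_mkcond big_pred1_eq. Qed.

Lemma prodm_expect_at P i (g : A -> R) : (forall l, \sum_a P l a = 1) ->
  \sum_f prodm P f * g (f i) = \sum_a P i a * g a.
Proof.
move=> P1; pose G l a := if l == i then g a else 1.
rewrite (eq_bigr (fun f => prodm P f * \prod_l G l (f l))); last first.
  by move=> f _; rewrite prod_at.
rewrite prodm_expect_prod (bigD1 i) //= [X in _ * X]big1 ?mulr1 ?/G ?eqxx // => l /negPf li.
by rewrite /G li -[RHS](P1 l); apply: eq_bigr => a _; rewrite mulr1.
Qed.

Lemma prodm_expect_at2 P i j (g h : A -> R) : (forall l, \sum_a P l a = 1) ->
  i != j ->
  \sum_f prodm P f * (g (f i) * h (f j)) =
  (\sum_a P i a * g a) * (\sum_a P j a * h a).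
Proof.
move=> P1 ij; pose G l a := (if l == i then g a else 1) * (if l == j then h a else 1).
rewrite (eq_bigr (fun f => prodm P f * \prod_l G l (f l))); last first.
  by move=> f _; rewrite big_split /= -!prod_at.
rewrite prodm_expect_prod (bigD1 i) //= (bigD1 j) 1?eq_sym //= [X in _ * (_ * X)]big1; last first.
  move=> l /andP[/negPf li /negPf lj]; rewrite /G li lj -[RHS](P1 l).
  by apply: eq_bigr => a _; rewrite !mulr1.
rewrite mulr1 /G !eqxx [j == i]eq_sym (negPf ij); congr (_ * _);
  by apply: eq_bigr => a _; rewrite ?mulr1 ?mul1r.
Qed.

Lemma prodm_expect_sum P (X : I -> A -> R) : (forall l, \sum_a P l a = 1) ->
  \sum_f prodm P f * \sum_i X i (f i) = \sum_i \sum_a P i a * X i a.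
Proof.
move=> P1; under eq_bigr do rewrite mulr_sumr.
by rewrite exchange_big; apply: eq_bigr => i _; rewrite prodm_expect_at.
Qed.

(** After expanding the square, the cross terms factor by independence and vanish by centring. *)
Lemma prodm_variance P (X : I -> A -> R) : (forall l, \sum_a P l a = 1) ->
  (forall i, \sum_a P i a * X i a = 0) ->
  \sum_f prodm P f * (\sum_i X i (f i)) ^+ 2 = \sum_i \sum_a P i a * X i a ^+ 2.
Proof.
move=> P1 X0.
under eq_bigr do rewrite expr2 mulr_suml mulr_sumr.
rewrite exchange_big; apply: eq_bigr => i _.
under eq_bigr do rewrite mulr_sumr mulr_sumr.
rewrite exchange_big (bigD1 i) //= [X in _ + X]big1 ?addr0.
  under eq_bigr do rewrite -expr2.
  by rewrite (@prodm_expect_at P i (fun a => X i a ^+ 2)).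
move=> j ji; rewrite prodm_expect_at2 1?eq_sym //.
by rewrite X0 mul0r.
Qed.

Lemma ent_prodm P : (forall i a, 0 <= P i a) -> (forall i, \sum_a P i a = 1) ->
  ent (prodm P) = \sum_i ent (P i).
Proof.
move=> P0 P1; rewrite /ent sumrN; congr (- _).
under [RHS]eq_bigr do under eq_bigr do rewrite xlog2xE.
rewrite -prodm_expect_sum //; apply: eq_bigr => f _; rewrite xlog2xE.
have [->|fn0] := eqVneq (prodm P f) 0; first by rewrite !mul0r.
congr (_ * _); have Pp i : 0 < P i (f i).
  rewrite lt_def P0 andbT; apply: contra_neq fn0 => h.
  by rewrite /prodm (bigD1 i) //= h mul0r.
(* Positivity is carried through the induction because [log2M] requires it at every factor. *)
suff : 0 < prodm P f /\ log2 (prodm P f) = \sum_i log2 (P i (f i)) by case.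
apply: (big_ind2 (fun u v => 0 < u /\ log2 u = v)) => [|x a y b [x0 <-] [y0 <-]|//].
  by rewrite log2_1.
by rewrite log2M // mulr_gt0.
Qed.

End Product.

(** * The binary symmetric channel and its entropy *)

Section Bsc.
Context {R : realType}.
Implicit Types (p q : R).

Lemma bsc_ge0 p x y : 0 <= p <= 1 -> 0 <= bsc p x y.
Proof. by move=> /andP[p0 p1]; rewrite /bsc; case: ifP; rewrite ?subr_ge0. Qed.

Lemma bscC p x y : bsc p x y = bsc p y x.
Proof. by rewrite /bsc eq_sym. Qed.

Lemma sum_bsc p x (F : bool -> R) :
  \sum_y bsc p x y * F y = (1 - p) * F x + p * F (~~ x).
Proof. by rewrite big_bool /bsc; case: x => //=; rewrite addrC. Qed.

Lemma bsc_sum1 p x : \sum_y bsc p x y = 1.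
Proof.
under eq_bigr do rewrite -[bsc _ _ _]mulr1.
by rewrite (sum_bsc _ _ (fun=> 1)); ring.
Qed.

Lemma ent_bsc p x : ent (bsc p x) = Hb p.
Proof.
rewrite /ent (eq_bigr (fun y => bsc p x y * log2 (bsc p x y))).
  by rewrite sum_bsc /bsc eqxx /Hb !xlog2xE; case: x => /=; ring.
by move=> y _; rewrite xlog2xE.
Qed.

(** Crossovers [p] and [a] in cascade give crossover [p + a * (1 - 2 * p)]; solving for [q] yields
    [a]. At [p = 1 / 2] the two channels coincide and [a = 0] serves. *)
Lemma bsc_degraded p q : 0 <= p -> p <= q -> q <= 2^-1 ->
  exists2 a : R, 0 <= a <= 1 &
    forall x z, bsc q x z = pushes (bsc a) (bsc p x) z.
Proof.
move=> p0 pq q2; have [p2|p2] := eqVneq p 2^-1.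
  have -> : q = p by apply/le_anti; rewrite pq p2 q2.
  exists 0; rewrite ?lexx ?ler01 // => x z.
  rewrite /pushes; under eq_bigr do rewrite mulrC.
  by rewrite sum_bsc /bsc; case: x z => [] [] /=; ring.
have p2' : p < 2^-1 by rewrite lt_neqAle p2 (le_trans pq).
have d0 : 0 < 1 - 2 * p by lra.
exists ((q - p) / (1 - 2 * p)).
  by rewrite divr_ge0 ?ler_pdivrMr ?(ltW d0) //; lra.
move=> x z; rewrite /pushes; under eq_bigr do rewrite mulrC.
by rewrite sum_bsc /bsc; case: x z => [] [] /=; field; rewrite gt_eqF.
Qed.

(** Degradation by a doubly stochastic channel can only raise the output entropy, so no derivative
    is taken. *)
Lemma Hb_le p q : 0 <= p -> p <= q -> q <= 2^-1 -> Hb p <= Hb q.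
Proof.
move=> p0 pq q2; have [a a01 h] := bsc_degraded p q p0 pq q2.
rewrite -(ent_bsc p true) -(ent_bsc q true) (eq_ent _ _ (h true)).
apply: ent_doubly_stochastic => *; rewrite ?bsc_ge0 ?bsc_sum1 //; last lra.
by under eq_bigr do rewrite bscC; rewrite bsc_sum1.
Qed.

Lemma Hb_le1 p : 0 <= p <= 1 -> Hb p <= 1.
Proof.
move=> p01; rewrite -(ent_bsc p true) -[leRHS]log2_2 -card_bool.
by apply: ent_le_log_card; rewrite ?bsc_sum1 // => y; rewrite bsc_ge0.
Qed.

End Bsc.

(** * The block-fading channel in a fixed state *)

Section Channel.
Context {R : realType} {N B : nat}.
Implicit Types (pa pb : R) (s : states B) (x y z : word N B).

Lemma chanE pa pb s x :
  chan pa pb s x = prodm (fun i => bsc (sel pa pb (s i.1)) (x i)).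
Proof. by []. Qed.

Lemma sel01 {pa pb : R} : 0 <= pa <= 1 -> 0 <= pb <= 1 ->
  forall k, 0 <= sel pa pb k <= 1.
Proof. by move=> ? ? k; rewrite /sel; case: ifP. Qed.

Lemma chan_ge0 pa pb s x y : 0 <= pa <= 1 -> 0 <= pb <= 1 ->
  0 <= chan pa pb s x y.
Proof. by move=> a01 b01; rewrite chanE; apply: prodm_ge0 => i a; rewrite bsc_ge0 // sel01. Qed.

Lemma chanC pa pb s x y : chan pa pb s x y = chan pa pb s y x.
Proof. by apply: eq_bigr => i _; rewrite bscC. Qed.

Lemma chan_sum1 pa pb s x : \sum_y chan pa pb s x y = 1.
Proof. by rewrite chanE prodm_sum1 // => i; rewrite bsc_sum1. Qed.

Lemma chan_sum1r pa pb s y : \sum_x chan pa pb s x y = 1.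
Proof. by under eq_bigr do rewrite chanC; rewrite chan_sum1. Qed.

(** The entropy of the output given the input word in state [s]; by symmetry of the channel it is
    the same for every input. *)
Definition Hstate pa pb s : R := \sum_(i : 'I_B * 'I_N) Hb (sel pa pb (s i.1)).

Lemma ent_chan pa pb s x : 0 <= pa <= 1 -> 0 <= pb <= 1 ->
  ent (chan pa pb s x) = Hstate pa pb s.
Proof.
move=> a01 b01; rewrite chanE ent_prodm.
- by apply: eq_bigr => i _; rewrite ent_bsc.
- by move=> i a; rewrite bsc_ge0 // sel01.
- by move=> i; rewrite bsc_sum1.
Qed.

Lemma chan_degraded pa pb qa qb : 0 <= pa -> pa <= qa -> qa <= 2^-1 ->
  0 <= pb -> pb <= qb -> qb <= 2^-1 ->
  exists T : states B -> word N B -> word N B -> R,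
  [/\ forall s y z, 0 <= T s y z, forall s y, \sum_z T s y z = 1,
      forall s z, \sum_y T s y z = 1 &
      forall s x z, chan qa qb s x z = pushes (T s) (chan pa pb s x) z].
Proof.
move=> pa0 paqa qa2 pb0 pbqb qb2.
have [a a01 ha] := bsc_degraded _ _ pa0 paqa qa2.
have [b b01 hb] := bsc_degraded _ _ pb0 pbqb qb2.
exists (fun s => chan a b s); split=> [s y z|s y|s z|s x z]; rewrite ?chan_ge0 ?chan_sum1 ?chan_sum1r //.
(* The sum over intermediate words factors letter by letter, leaving the one-letter cascades [ha]
   and [hb]. *)
rewrite /pushes /chan; under [RHS]eq_bigr do rewrite -big_split.
rewrite -(bigA_distr_bigA (fun i c => bsc (sel a b (s i.1)) c (z i) *
  bsc (sel pa pb (s i.1)) (x i) c)).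
by apply: eq_bigr => i _; rewrite /sel; case: ifP => _; rewrite ?ha ?hb.
Qed.

Lemma card_word : #|{: word N B}| = (2 ^ (N * B))%N.
Proof. by rewrite card_ffun card_bool card_prod !card_ord mulnC. Qed.

Lemma ent_word_le (P : word N B -> R) : (forall y, 0 <= P y) ->
  \sum_y P y = 1 -> ent P <= (N * B)%:R.
Proof.
move=> P0 P1; apply: (le_trans (ent_le_log_card _ P0 P1)).
by rewrite card_word natrX -powR_mulrn // log2_pow2.
Qed.

End Channel.

(** * Averages over the fading states *)

Section State.
Context {R : realType} {B : nat}.
Implicit Types (q : R) (s : states B).

Lemma Pstate_ge0 q s : 0 <= q <= 1 -> 0 <= Pstate q s.
Proof.
move=> q01; apply: prodr_ge0 => k _.
suff /andP[] : 0 <= sel q (1 - q) (s k) <= 1 by [].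
apply: sel01 => //; lra.
Qed.

Lemma sum_sel (q : R) (F : 'I_2 -> R) :
  \sum_k sel q (1 - q) k * F k = q * F ord0 + (1 - q) * F ord_max.
Proof.
rewrite big_ord_recl big_ord1 /sel /=; congr (_ + _ * F _).
by apply/val_inj.
Qed.

Lemma sel_sum1 q : \sum_k sel q (1 - q) k = 1.
Proof.
under eq_bigr do rewrite -[sel _ _ _]mulr1.
by rewrite (sum_sel _ (fun=> 1)); ring.
Qed.

Lemma Pstate_sum1 q : \sum_(s : states B) Pstate q s = 1.
Proof. by rewrite (@prodm_sum1 _ _ _ (fun=> sel q (1 - q))) // => k; exact: sel_sum1. Qed.

(** By linearity only the marginal state of each letter matters, although the letters of a block
    share their state. *)
Lemma Pstate_Hstate q pa pb (N : nat) :
  \sum_(s : states B) Pstate q s * Hstate (N := N) pa pb s =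
  (N * B)%:R * (q * Hb pa + (1 - q) * Hb pb).
Proof.
rewrite /Hstate; under eq_bigr do rewrite mulr_sumr.
rewrite exchange_big /= (eq_bigr (fun=> q * Hb pa + (1 - q) * Hb pb)).
  by rewrite sumr_const card_prod !card_ord mulnC mulr_natl.
move=> i _.
rewrite (prodm_expect_at (fun=> sel q (1 - q)) i.1 (fun k => Hb (sel pa pb k))).
  by rewrite sum_sel.
by move=> _; exact: sel_sum1.
Qed.

End State.

(** * Converse *)

Arguments csize {R N B} c.
Arguments csize_gt0 {R N B} c.
Arguments cenc {R N B} c m x.
Arguments cenc_ge0 {R N B} c m x.
Arguments cenc_sum1 {R N B} c m.
Arguments cdec {R N B} c s y.

(** * The converse bound for a single code *)

Section Code.
Context {R : realType} {N B : nat}.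
Implicit Types (C : @Defs.code R N B) (s : states B) (q pa pb : R).

Definition unif C : 'I_(csize C) -> R := fun=> (csize C)%:R^-1.

Lemma unif_gt0 C m : 0 < unif C m.
Proof. by rewrite invr_gt0 ltr0n csize_gt0. Qed.

Lemma unif_sum1 C : \sum_m unif C m = 1.
Proof.
by rewrite sumr_const card_ord -[LHS]mulr_natl mulfV // pnatr_eq0 -lt0n csize_gt0.
Qed.

Lemma PoutE pa pb C s m : Pout pa pb C s m = mix (cenc C m) (chan pa pb s).
Proof. by []. Qed.

Lemma Pout_ge0 pa pb C s m y : 0 <= pa <= 1 -> 0 <= pb <= 1 ->
  0 <= Pout pa pb C s m y.
Proof.
by move=> a01 b01; apply: mix_ge0 => *; rewrite ?cenc_ge0 ?chan_ge0.
Qed.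

Lemma Pout_sum1 pa pb C s m : \sum_y Pout pa pb C s m y = 1.
Proof.
rewrite exchange_big -[RHS](cenc_sum1 C m); apply: eq_bigr => x _.
by rewrite -mulr_sumr chan_sum1 mulr1.
Qed.

Lemma leakE q pa pb C : 0 <= pa <= 1 -> 0 <= pb <= 1 ->
  leak q pa pb C = \sum_s Pstate q s * info (unif C) (Pout pa pb C s).
Proof.
move=> a01 b01; apply: eq_bigr => s _; congr (_ * _).
rewrite -(mutual_infoE (unif C)) // => [m|m y|m]; rewrite ?Pout_sum1 //.
  exact: ltW (unif_gt0 _ _).
exact: Pout_ge0.
Qed.

Definition psucc q pa pb C : R := \sum_s Pstate q s *
  \sum_m unif C m * \sum_y Pout pa pb C s m y * (cdec C s y == m)%:R.

Lemma perrE q pa pb C : perr q pa pb C = 1 - psucc q pa pb C.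
Proof.
apply/esym/eqP; rewrite subr_eq /perr /psucc -big_split /=; apply/eqP.
rewrite -[LHS](Pstate_sum1 (B := B) q).
apply: eq_bigr => s _; rewrite -mulrDr -big_split /= -{1}[Pstate q s]mulr1.
congr (_ * _); rewrite -[LHS](unif_sum1 C); apply: eq_bigr => m _.
rewrite -mulrDr -big_split /= -{1}[unif C m]mulr1; congr (_ * _).
rewrite -[LHS](Pout_sum1 pa pb C s m); apply: eq_bigr => y _.
by rewrite -mulrDr; case: eqP => _ /=; rewrite ?add0r ?addr0 mulr1.
Qed.

Lemma perr_ge0 q pa pb C : 0 <= q <= 1 -> 0 <= pa <= 1 -> 0 <= pb <= 1 ->
  0 <= perr q pa pb C.
Proof.
move=> q01 a01 b01; rewrite sumr_ge0 // => s _; rewrite mulr_ge0 ?Pstate_ge0 //.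
rewrite sumr_ge0 // => m _; rewrite mulr_ge0 ?(ltW (unif_gt0 _ _)) //.
by rewrite sumr_ge0 // => y _; rewrite mulr_ge0 ?Pout_ge0 ?ler0n.
Qed.

Lemma info_cenc pa pb C s m : 0 <= pa <= 1 -> 0 <= pb <= 1 ->
  info (cenc C m) (chan pa pb s) = ent (Pout pa pb C s m) - Hstate (N := N) pa pb s.
Proof.
move=> a01 b01; rewrite /info; congr (_ - _).
rewrite (eq_bigr (fun x => cenc C m x * Hstate (N := N) pa pb s)).
  by rewrite -mulr_suml cenc_sum1 mul1r.
by move=> x _; rewrite ent_chan.
Qed.

(** The heart of the converse, for one state: the difference splits into a conditional part, bounded
    by [gap], and an output part, nonpositive by [out]. *)
Lemma info_gap {pa pb qa qb : R} (C : Defs.code N B) s :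
  0 <= pa -> pa <= qa -> qa <= 2^-1 -> 0 <= pb -> pb <= qb -> qb <= 2^-1 ->
  info (unif C) (Pout pa pb C s) - info (unif C) (Pout qa qb C s) <=
  Hstate (N := N) qa qb s - Hstate (N := N) pa pb s.
Proof.
move=> pa0 paqa qa2 pb0 pbqb qb2.
have a01 : 0 <= pa <= 1 by lra.
have b01 : 0 <= pb <= 1 by lra.
have qa01 : 0 <= qa <= 1 by lra.
have qb01 : 0 <= qb <= 1 by lra.
have [T [T0 T1 T1' TE]] := @chan_degraded _ N B _ _ _ _ pa0 paqa qa2 pb0 pbqb qb2.
have chanT : chan qa qb s = fun x => pushes (T s) (chan pa pb s x).
  by apply/funext => x; apply/funext => z; rewrite TE.
(* Data processing for the input word given the message [m], through the degrading channel [T s]. *)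
have gap m : ent (Pout qa qb C s m) - ent (Pout pa pb C s m) <=
    Hstate (N := N) qa qb s - Hstate (N := N) pa pb s.
  have : info (cenc C m) (chan qa qb s) <= info (cenc C m) (chan pa pb s).
    rewrite chanT; apply: info_data_processing => //; first exact: cenc_ge0.
    by move=> x y; rewrite chan_ge0.
  by rewrite !info_cenc //; lra.
have out : ent (mix (unif C) (Pout pa pb C s)) <= ent (mix (unif C) (Pout qa qb C s)).
  have -> : mix (unif C) (Pout qa qb C s) = pushes (T s) (mix (unif C) (Pout pa pb C s)).
    apply/funext => z; rewrite pushes_mix; congr (mix _ _ _).
    apply/funext => m; apply/funext => z'.
    by rewrite !PoutE pushes_mix chanT.
  apply: ent_doubly_stochastic => // y; apply: mix_ge0 => *.
    exact: ltW (unif_gt0 _ _).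
  exact: Pout_ge0.
rewrite /info.
have : \sum_m unif C m * (ent (Pout qa qb C s m) - ent (Pout pa pb C s m)) <=
    \sum_m unif C m * (Hstate (N := N) qa qb s - Hstate (N := N) pa pb s).
  by apply: ler_sum => m _; rewrite ler_pM2l ?unif_gt0.
rewrite -mulr_suml unif_sum1 mul1r.
under eq_bigr do rewrite mulrBr.
rewrite sumrB; lra.
Qed.

(** Fano's inequality for the legitimate receiver plus [info_gap], state by state; the average of
    [Hstate] then gives the single-letter expression. *)
Lemma code_converse {q p1 p2 ps1 ps2 : R} C : 0 <= q <= 1 ->
  0 <= p1 -> p1 <= ps1 -> ps1 <= 2^-1 -> 0 <= p2 -> p2 <= ps2 -> ps2 <= 2^-1 ->
  (1 - perr q p1 p2 C) * log2 (csize C)%:R - 1 <= leak q ps1 ps2 C +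
  (N * B)%:R * (q * (Hb ps1 - Hb p1) + (1 - q) * (Hb ps2 - Hb p2)).
Proof.
move=> q01 p10 p1s s1 p20 p2s s2.
have a01 : 0 <= p1 <= 1 by lra.
have b01 : 0 <= p2 <= 1 by lra.
rewrite perrE subKr leakE; [|lra|lra].
have -> : (N * B)%:R * (q * (Hb ps1 - Hb p1) + (1 - q) * (Hb ps2 - Hb p2)) =
  \sum_(s : states B) Pstate q s * (Hstate (N := N) ps1 ps2 s - Hstate (N := N) p1 p2 s).
  under [RHS]eq_bigr do rewrite mulrBr.
  by rewrite sumrB !Pstate_Hstate; ring.
rewrite -[X in _ - X <= _](Pstate_sum1 (B := B) q) mulr_suml -sumrB -big_split /=.
apply: ler_sum => s _; rewrite -mulrA -[X in _ - X]mulr1 -mulrBr -mulrDr.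
apply: ler_wpM2l; first exact: Pstate_ge0.
have := info_gap C s p10 p1s s1 p20 p2s s2.
have := @fano _ _ _ (Pout p1 p2 C s) (cdec C s).
rewrite card_ord csize_gt0 -/(unif C) => /(_ isT) fanoC.
have {}fanoC := fanoC (fun m y => Pout_ge0 _ _ _ _ _ _ a01 b01)
  (fun m => Pout_sum1 _ _ _ _ _).
move: fanoC; rewrite -/(unif C); set S := \sum_u _; lra.
Qed.

End Code.

(** * The converse in the limit *)

Section Converse.
Context {R : realType}.

Lemma achievable_le (q p1 p2 ps1 ps2 r : R) : 0 <= q <= 1 ->
  0 <= p1 -> p1 <= ps1 -> ps1 <= 2^-1 -> 0 <= p2 -> p2 <= ps2 -> ps2 <= 2^-1 ->
  achievable q p1 p2 ps1 ps2 r ->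
  r <= q * (Hb ps1 - Hb p1) + (1 - q) * (Hb ps2 - Hb p2).
Proof.
move=> q01 p10 p1s s1 p20 p2s s2 [N [B [C [NB [rateC [perrC leakC]]]]]].
have conv t := code_converse (C t) q01 p10 p1s s1 p20 p2s s2.
set cap := (X in r <= X) in conv *.
have a01 : 0 <= p1 <= 1 by lra.
have b01 : 0 <= p2 <= 1 by lra.
(* The rate slack, the leakage and the Fano term [n^-1] each cost at most [e], and the error
   probability costs at most [e * |r|]. *)
suff key : forall e, 0 < e -> r <= cap + (4 + `|r|) * e.
  apply/ler_addgt0Pr => e e0; have k0 : 0 < 4 + `|r| by rewrite ltr_pwDl.
  have := key (e / (4 + `|r|)) (divr_gt0 e0 k0).
  by rewrite [X in _ + X]mulrC divfK ?gt_eqF.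
(* With [e <= 1] the success probability [1 - P] is nonnegative, so inequalities may be multiplied
   by it. *)
suff key : forall e, 0 < e <= 1 -> r <= cap + (4 + `|r|) * e.
  move=> e e0; have [e1|/ltW e1] := leP e 1; first by rewrite key ?e0.
  apply: (le_trans (key 1 _)); first by rewrite ltr01 lexx.
  by rewrite lerD2l ler_wpM2l // addr_ge0.
move=> e /andP[e0 e1].
have [K Ke] : exists K : nat, e^-1 <= K%:R.
  by exists (Num.truncn e^-1).+1; apply/ltW/truncnS_gt.
have K0 : (0 < K)%N by rewrite -(ltr_nat R) (lt_le_trans _ Ke) ?invr_gt0.
have [t [[NK BK] ratet perrt leakt]] : exists t, [/\ (K <= N t)%N /\ (K <= B t)%N,
    r - e <= rate (C t), `|perr q p1 p2 (C t)| <= e &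
    `|leak q ps1 ps2 (C t) / (N t * B t)%:R| <= e].
  have [|t] := @filter_ex nat \oo _ (fun t => [/\ (K <= N t)%N /\ (K <= B t)%N,
    r - e <= rate (C t), `|perr q p1 p2 (C t)| <= e &
    `|leak q ps1 ps2 (C t) / (N t * B t)%:R| <= e]); last by exists t.
  near=> t; split.
  - by near: t; exact: NB.
  - by near: t; exact: rateC.
  - by near: t; move/cvgr0Pnorm_le: perrC; apply.
  - by near: t; move/cvgr0Pnorm_le: leakC; apply.
have := conv t; have := perr_ge0 q p1 p2 (C t) q01 a01 b01.
move: perrt leakt ratet; set P := perr _ _ _ _; rewrite /rate.
set lM := log2 _; set n : R := (N t * B t)%:R; set lk := leak _ _ _ _.
move=> Pe lke re P0 cv.
have nK : K%:R <= n by rewrite ler_nat (leq_trans NK) // leq_pmulr // (leq_trans K0).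
have n0 : 0 < n by rewrite (lt_le_trans _ nK) // ltr0n.
clearbody n lM lk P.
have ne : n^-1 <= e.
  by rewrite -[e]invrK lef_pV2 ?posrE ?invr_gt0 // (le_trans Ke).
have {}cv : (1 - P) * (lM / n) - n^-1 <= lk / n + cap.
  rewrite -(ler_pM2r n0).
  have -> : ((1 - P) * (lM / n) - n^-1) * n = (1 - P) * lM - 1.
    by field; rewrite gt_eqF.
  by have -> : (lk / n + cap) * n = lk + n * cap by field; rewrite gt_eqF.
have {}lke := le_trans (ler_norm _) lke.
have {}Pe := le_trans (ler_norm _) Pe.
have : (1 - P) * (r - e) <= (1 - P) * (lM / n) by rewrite ler_wpM2l //; lra.
have : P * r <= e * `|r|.
  by rewrite (le_trans (ler_norm _)) // normrM (ger0_norm P0) ler_wpM2r.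
nra.
Unshelve. all: by end_near.
Qed.

End Converse.

(** * Random coding *)

Section Typicality.
Context {R : realType} {N B : nat}.
Implicit Types (pa pb q d tau : R) (s : states B) (x y : word N B).

Definition Havg q pa pb : R := q * Hb pa + (1 - q) * Hb pb.

Definition log_moment2 (p : R) : R := (1 - p) * log2 (1 - p) ^+ 2 + p * log2 p ^+ 2.

(** A variance is at most the second moment. *)
Lemma bsc_log_variance (p : R) (x0 : bool) : 0 <= p <= 1 ->
  \sum_b bsc p x0 b * (- log2 (bsc p x0 b) - Hb p) ^+ 2 <= log_moment2 p.
Proof.
move=> p01; rewrite sum_bsc /bsc eqxx.
have -> : (x0 == ~~ x0) = false by case: x0.
rewrite /Hb !xlog2xE /log_moment2.
set u := log2 (1 - p); set v := log2 p.
have := sqr_ge0 ((1 - p) * u + p * v).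
have -> : (1 - p) * (- u - (- (p * v) - (1 - p) * u)) ^+ 2 +
          p * (- v - (- (p * v) - (1 - p) * u)) ^+ 2 =
  (1 - p) * u ^+ 2 + p * v ^+ 2 - ((1 - p) * u + p * v) ^+ 2 by ring.
by move=> ?; rewrite gerBl.
Qed.

Definition atypical q pa pb tau x : R := \sum_(s : states B) Pstate q s *
  \sum_y chan pa pb s x y * (chan pa pb s x y < tau)%R%:R.

(** The numerator in Chebyshev's bound; the factor 2 comes from bounding the square of a sum by
    twice the sum of the squares. *)
Definition cheb_const pa pb : R :=
  2 * (log_moment2 pa + log_moment2 pb + Hb pa ^+ 2 + Hb pb ^+ 2).

Lemma log_moment2_ge0 (p : R) : 0 <= p <= 1 -> 0 <= log_moment2 p.
Proof.
by move=> /andP[p0 p1]; rewrite /log_moment2 addr_ge0 // mulr_ge0 ?sqr_ge0 ?subr_ge0.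
Qed.

Lemma cheb_const_ge0 pa pb : 0 <= pa <= 1 -> 0 <= pb <= 1 -> 0 <= cheb_const pa pb.
Proof.
move=> a01 b01; apply: mulr_ge0 => //.
have := log_moment2_ge0 _ a01; have := log_moment2_ge0 _ b01.
have := sqr_ge0 (Hb pa); have := sqr_ge0 (Hb pb); lra.
Qed.

Lemma noise_variance pa pb s x : 0 <= pa <= 1 -> 0 <= pb <= 1 ->
  \sum_y chan pa pb s x y * (\sum_i (- log2 (bsc (sel pa pb (s i.1)) (x i) (y i))
    - Hb (sel pa pb (s i.1)))) ^+ 2 <=
  (N * B)%:R * (log_moment2 pa + log_moment2 pb).
Proof.
move=> a01 b01; pose P (i : 'I_B * 'I_N) := bsc (sel pa pb (s i.1)) (x i).
rewrite (@prodm_variance R _ _ P (fun i b => - log2 (P i b) - Hb (sel pa pb (s i.1)))).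
- have -> : (N * B)%:R * (log_moment2 pa + log_moment2 pb) =
      \sum_(i : 'I_B * 'I_N) (log_moment2 pa + log_moment2 pb).
    by rewrite sumr_const card_prod !card_ord mulnC mulr_natl.
  apply: ler_sum => i _; apply: (le_trans (bsc_log_variance _ _ (sel01 a01 b01 _))).
  by rewrite /sel; case: ifP => _; rewrite ?lerDl ?lerDr log_moment2_ge0.
- by move=> i; rewrite bsc_sum1.
- move=> i; under eq_bigr do rewrite mulrBr.
  rewrite sumrB -mulr_suml bsc_sum1 mul1r -(ent_bsc _ (x i)) /ent.
  rewrite -sumrN -sumrB big1 // => b _.
  by rewrite xlog2xE mulrN opprK addNr.
Qed.

(** The letters of a block share their state, so the deviation is [N] times a sum over [B]
    independent blocks. The variance grows like [N ^ 2 * B], which is small against [(N * B) ^ 2]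
    once [B] is large. *)
Lemma state_variance q pa pb : 0 <= q <= 1 ->
  \sum_(s : states B) Pstate q s *
    (\sum_(i : 'I_B * 'I_N) (Hb (sel pa pb (s i.1)) - Havg q pa pb)) ^+ 2 <=
  N%:R ^+ 2 * (B%:R * (Hb pa ^+ 2 + Hb pb ^+ 2)).
Proof.
move=> q01; pose X (k : 'I_2) : R := Hb (sel pa pb k) - Havg q pa pb.
rewrite (eq_bigr (fun s => N%:R ^+ 2 * (Pstate q s * (\sum_k X (s k)) ^+ 2))).
  rewrite -mulr_sumr ler_wpM2l ?sqr_ge0 //.
  rewrite (@prodm_variance R _ _ (fun=> sel q (1 - q)) (fun=> X)).
  - rewrite sumr_const card_ord -[leLHS]mulr_natl ler_wpM2l ?ler0n //.
    rewrite (sum_sel q (fun k => X k ^+ 2)) /X /Havg /sel /=.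
    set u := Hb pa; set v := Hb pb; have := sqr_ge0 u; have := sqr_ge0 v.
    have := sqr_ge0 (q * u + (1 - q) * v); nra.
  - by move=> _; exact: sel_sum1.
  - by move=> _; rewrite sum_sel /X /Havg /sel /=; ring.
move=> s _; rewrite [RHS]mulrCA -exprMn; congr (_ * _ ^+ 2).
rewrite -(pair_bigA _ (fun k (_ : 'I_N) => X (s k))) /= mulr_sumr.
by apply: eq_bigr => k _; rewrite sumr_const card_ord mulr_natl.
Qed.

Definition threshold q pa pb d : R := 2 `^ (- ((N * B)%:R * (Havg q pa pb + d))).

Lemma log2_chan pa pb s x y : 0 <= pa <= 1 -> 0 <= pb <= 1 ->
  0 < chan pa pb s x y ->
  log2 (chan pa pb s x y) = \sum_i log2 (bsc (sel pa pb (s i.1)) (x i) (y i)).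
Proof.
move=> a01 b01 /lt0r_neq0 /prodf_neq0 c0.
suff : 0 < chan pa pb s x y /\ log2 (chan pa pb s x y) =
   \sum_i log2 (bsc (sel pa pb (s i.1)) (x i) (y i)) by case.
rewrite /chan; apply: (big_ind2 (fun u v => 0 < u /\ log2 u = v)) =>
  [|u a v b [u0 <-] [v0 <-]|i _].
- by rewrite log2_1.
- by rewrite log2M // mulr_gt0.
- by rewrite lt_def c0 // bsc_ge0 // sel01.
Qed.

(* Chebyshev's inequality for the information density, whose deviation splits
   into a part due to the noise and a part due to the fading state. *)
Lemma atypical_le q pa pb d x : (0 < N)%N -> (0 < B)%N -> 0 < d ->
  0 <= q <= 1 -> 0 <= pa <= 1 -> 0 <= pb <= 1 ->
  atypical q pa pb (threshold q pa pb d) x <= cheb_const pa pb / (B%:R * d ^+ 2).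
Proof.
move=> N0 B0 d0 q01 a01 b01; set n : R := (N * B)%:R.
pose U s y := \sum_(i : 'I_B * 'I_N) (- log2 (bsc (sel pa pb (s i.1)) (x i) (y i))
    - Hb (sel pa pb (s i.1))).
pose W s := \sum_(i : 'I_B * 'I_N) (Hb (sel pa pb (s i.1)) - Havg q pa pb).
have n0 : 0 < n by rewrite ltr0n muln_gt0 N0.
have nd0 : 0 < (n * d) ^+ 2 by rewrite exprn_gt0 // mulr_gt0.
(* A likelihood below the threshold forces [U + W >= n * d]. Outputs of probability 0 carry no
   weight and are removed before taking logarithms. *)
have pointwise s y : chan pa pb s x y * (chan pa pb s x y < threshold q pa pb d)%R%:R
    * (n * d) ^+ 2 <= chan pa pb s x y * (2 * U s y ^+ 2 + 2 * W s ^+ 2).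
  have [->|cn0] := eqVneq (chan pa pb s x y) 0; first by rewrite !mul0r.
  have cp : 0 < chan pa pb s x y by rewrite lt_def cn0 chan_ge0.
  rewrite -mulrA ler_pM2l //.
  have [ct|_] := ltP; last by rewrite mul0r addr_ge0 // mulr_ge0 ?sqr_ge0.
  have dev : n * d <= U s y + W s.
    have := ltr_log2 _ _ cp ct; rewrite log2_pow2 -/n log2_chan //.
    rewrite /U /W !sumrB sumrN sumr_const card_prod !card_ord mulnC.
    rewrite -[_ *+ (N * B)]mulr_natl -/n; lra.
  rewrite mul1r (@le_trans _ _ ((U s y + W s) ^+ 2)) //.
    by rewrite lerXn2r ?nnegrE ?(le_trans _ dev) // ltW // mulr_gt0.
  have := sqr_ge0 (U s y - W s); lra.
rewrite -(ler_pM2r nd0).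
apply: (@le_trans _ _ (2 * (n * (log_moment2 pa + log_moment2 pb)) +
    2 * (N%:R ^+ 2 * (B%:R * (Hb pa ^+ 2 + Hb pb ^+ 2))))).
  apply: (@le_trans _ _ (\sum_(s : states B) Pstate q s *
     (2 * \sum_y chan pa pb s x y * U s y ^+ 2 + 2 * W s ^+ 2))).
    rewrite mulr_suml; apply: ler_sum => s _; rewrite -mulrA.
    apply: ler_wpM2l; first exact: Pstate_ge0.
    rewrite (_ : 2 * _ + _ = \sum_y chan pa pb s x y * (2 * U s y ^+ 2 + 2 * W s ^+ 2)).
      by rewrite mulr_suml; apply: ler_sum => y _; exact: pointwise.
    under [RHS]eq_bigr do rewrite mulrDr mulrCA.
    by rewrite big_split /= -mulr_suml chan_sum1 mul1r mulr_sumr.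
  under eq_bigr do rewrite mulrDr [_ * (2 * W _ ^+ 2)]mulrCA [_ * (2 * \sum_y _)]mulrCA.
  rewrite big_split -!mulr_sumr; apply: lerD; rewrite ler_pM2l //; last exact: state_variance.
  rewrite -[leRHS]mul1r -(Pstate_sum1 (B := B) q) mulr_suml; apply: ler_sum => s _.
  apply: ler_wpM2l; first exact: Pstate_ge0.
  exact: noise_variance.
rewrite /cheb_const; set u := log_moment2 pa + log_moment2 pb.
have u0 : 0 <= u by rewrite addr_ge0 // log_moment2_ge0.
rewrite -addrA -/u; set v := Hb pa ^+ 2 + Hb pb ^+ 2.
have Nr0 : 1 <= N%:R :> R by rewrite ler1n.
have Br0 : 0 < B%:R :> R by rewrite ltr0n.
have -> : 2 * (u + v) / (B%:R * d ^+ 2) * (n * d) ^+ 2 = 2 * (u + v) * N%:R ^+ 2 * B%:R.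
  by rewrite /n natrM; field; rewrite !gt_eqF.
(* Puts the noise variance, of order [N * B], on the scale [N ^ 2 * B] of the fading variance. *)
have NN : N%:R <= N%:R ^+ 2 :> R by rewrite expr2 ler_peMl // ler0n.
have := ler_wpM2r (mulr_ge0 u0 (ltW Br0)) NN.
rewrite /n natrM; lra.
Qed.

End Typicality.

(** * Threshold decoding of random codebooks *)

Section Decoding.
Context {R : realType} {N B : nat}.
Implicit Types (pa pb q tau : R) (s : states B) (x y : word N B).

Definition collision q pa pb tau x x' : R := \sum_(s : states B) Pstate q s *
  \sum_y chan pa pb s x y * (tau <= chan pa pb s x' y)%R%:R.

Definition thr_dec {J : finType} pa pb tau (j0 : J) (F : J -> word N B) s y : J :=
  odflt j0 [pick j | tau <= chan pa pb s (F j) y].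

Definition dec_err {J : finType} q pa pb tau (j0 : J) (F : J -> word N B) j : R :=
  \sum_(s : states B) Pstate q s * \sum_y chan pa pb s (F j) y *
    (thr_dec pa pb tau j0 F s y != j)%:R.

(** If the true index passes the threshold and no other does, [pick] can only return it; every other
    case is counted on the right. *)
Lemma thr_dec_err {J : finType} pa pb tau (j0 : J) (F : J -> word N B) s y j :
  (thr_dec pa pb tau j0 F s y != j)%:R <=
  (chan pa pb s (F j) y < tau)%R%:R +
  \sum_(j' | j' != j) (tau <= chan pa pb s (F j') y)%R%:R :> R.
Proof.
rewrite /thr_dec; case: ltP => [_|good] /=.
  rewrite (@le_trans _ _ 1) //; first by case: (_ != _); rewrite ?ler01.
  by rewrite lerDl sumr_ge0.
rewrite add0r; case: pickP => [i goodi|/(_ j)] /=; last by rewrite good.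
have [_|ij] := eqVneq i j; first by rewrite sumr_ge0.
by rewrite (bigD1 i) //= goodi lerDl sumr_ge0.
Qed.

Lemma dec_err_le {J : finType} q pa pb tau (j0 : J) (F : J -> word N B) j :
  0 <= q <= 1 -> 0 <= pa <= 1 -> 0 <= pb <= 1 ->
  dec_err q pa pb tau j0 F j <= atypical q pa pb tau (F j) +
  \sum_(j' | j' != j) collision q pa pb tau (F j) (F j').
Proof.
move=> q01 a01 b01; rewrite exchange_big -big_split /=; apply: ler_sum => s _.
rewrite -mulr_sumr -mulrDr; apply: ler_wpM2l; first exact: Pstate_ge0.
rewrite exchange_big -big_split /=; apply: ler_sum => y _.
rewrite -mulr_sumr -mulrDr; apply: ler_wpM2l; first exact: chan_ge0.
exact: thr_dec_err.
Qed.

Lemma dec_err_ge0 {J : finType} q pa pb tau (j0 : J) (F : J -> word N B) j :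
  0 <= q <= 1 -> 0 <= pa <= 1 -> 0 <= pb <= 1 -> 0 <= dec_err q pa pb tau j0 F j.
Proof.
move=> q01 a01 b01; apply: sumr_ge0 => s _; rewrite mulr_ge0 ?Pstate_ge0 //.
by apply: sumr_ge0 => y _; rewrite mulr_ge0 ?chan_ge0.
Qed.

Definition codebook_law (J : finType) : {ffun J -> word N B} -> R :=
  prodm (fun=> fun=> #|{: word N B}|%:R^-1).

Lemma card_word_gt0 : 0 < #|{: word N B}|%:R :> R.
Proof. by rewrite card_word ltr0n expn_gt0. Qed.

Lemma uniform_word_sum1 : \sum_(x : word N B) #|{: word N B}|%:R^-1 = 1 :> R.
Proof. by rewrite sumr_const -[LHS]mulr_natl mulfV // gt_eqF ?card_word_gt0. Qed.

Lemma codebook_law_ge0 (J : finType) F : 0 <= codebook_law J F.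
Proof. by apply: prodm_ge0 => *; rewrite invr_ge0. Qed.

Lemma codebook_law_sum1 (J : finType) : \sum_F codebook_law J F = 1.
Proof. by apply: prodm_sum1 => _; exact: uniform_word_sum1. Qed.

(** The two codewords are independent. For fixed [y], Markov's inequality bounds the chance that a
    uniform word passes the threshold, since the likelihoods of [y] sum to 1 over the inputs. *)
Lemma expect_collision (J : finType) q pa pb tau (i j : J) :
  0 < tau -> i != j -> 0 <= q <= 1 -> 0 <= pa <= 1 -> 0 <= pb <= 1 ->
  \sum_F codebook_law J F * collision q pa pb tau (F i) (F j) <=
  (#|{: word N B}|%:R * tau)^-1.
Proof.
move=> t0 ij q01 a01 b01; set W : R := #|_|%:R.
have W0 : 0 < W := card_word_gt0.
under eq_bigr do rewrite mulr_sumr.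
rewrite exchange_big /= -[leRHS]mul1r -[X in _ <= X * _](Pstate_sum1 (B := B) q) mulr_suml.
apply: ler_sum => s _; under eq_bigr do rewrite mulrCA.
rewrite -mulr_sumr; apply: ler_wpM2l; first exact: Pstate_ge0.
under eq_bigr do rewrite mulr_sumr.
rewrite exchange_big /= invfM -[leRHS]mul1r -[X in _ <= X * _]uniform_word_sum1 mulr_suml.
apply: ler_sum => y _.
rewrite [leLHS](@prodm_expect_at2 R _ _ (fun=> fun=> W^-1) i j (fun x => chan pa pb s x y)
  (fun x => (tau <= chan pa pb s x y)%R%:R)) //; last by move=> _; exact: uniform_word_sum1.
rewrite -!mulr_sumr chan_sum1r mulr1; do 2![apply: ler_wpM2l; first by rewrite invr_ge0 ltW].
rewrite -[leRHS]mul1r -[X in _ <= X * _](chan_sum1r pa pb s y) mulr_suml; apply: ler_sum => x _.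
have [h|_] := leP tau (chan pa pb s x y); first by rewrite ler_pdivlMr // mul1r.
by rewrite divr_ge0 ?chan_ge0 // ltW.
Qed.

Lemma exists_le_expect (J : finType) (g : {ffun J -> word N B} -> R) c :
  \sum_F codebook_law J F * g F <= c -> exists F, g F <= c.
Proof.
move=> gc; pose F0 := [arg min_(F < [ffun=> [ffun=> false]] : {ffun J -> word N B}) g F]%O.
exists F0; apply: le_trans gc; rewrite -[leLHS]mul1r -(codebook_law_sum1 J) mulr_suml.
apply: ler_sum => F _; apply: ler_wpM2l; first exact: codebook_law_ge0.
by rewrite /F0; case: Order.TotalTheory.arg_minP => // i _; apply.
Qed.

End Decoding.

Lemma avg_cst {R : realType} (n : nat) (c : R) : \sum_(i < n.+1) n.+1%:R^-1 * c = c.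
Proof.
by rewrite sumr_const card_ord -[LHS]mulr_natl mulrA mulfV ?mul1r ?pnatr_eq0.
Qed.

Section Average.
Context {R : realType} {M L : nat}.
Implicit Types (X Y : 'I_M.+1 -> 'I_L.+1 -> R).

Definition avg2 X : R := \sum_m M.+1%:R^-1 * \sum_l L.+1%:R^-1 * X m l.

Lemma avg2_le X Y : (forall m l, X m l <= Y m l) -> avg2 X <= avg2 Y.
Proof.
move=> XY; apply: ler_sum => m _; rewrite ler_pM2l ?invr_gt0 //.
by apply: ler_sum => l _; rewrite ler_pM2l ?invr_gt0.
Qed.

Lemma avg2D X Y : avg2 (fun m l => X m l + Y m l) = avg2 X + avg2 Y.
Proof.
rewrite -big_split; apply: eq_bigr => m _; rewrite /= -mulrDr -big_split.
by congr (_ * _); apply: eq_bigr => l _; rewrite /= -mulrDr.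
Qed.

Lemma avg2_cst (c : R) : avg2 (fun _ _ => c) = c.
Proof.
by rewrite /avg2; under eq_bigr do rewrite avg_cst; rewrite avg_cst.
Qed.

Lemma avg2_linear {I : finType} (k : I -> R) (X : I -> 'I_M.+1 -> 'I_L.+1 -> R) :
  \sum_i k i * avg2 (X i) = avg2 (fun m l => \sum_i k i * X i m l).
Proof.
under eq_bigr do rewrite mulr_sumr.
rewrite exchange_big; apply: eq_bigr => m _ /=.
under eq_bigr do rewrite mulrCA mulr_sumr.
rewrite -mulr_sumr exchange_big; congr (_ * _); apply: eq_bigr => l _ /=.
by under eq_bigr do rewrite mulrCA; rewrite -mulr_sumr.
Qed.

Lemma avg2_ge0 X : (forall m l, 0 <= X m l) -> 0 <= avg2 X.
Proof. by move=> X0; rewrite -(avg2_cst 0); exact: avg2_le. Qed.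

End Average.

(** * The wiretap code with a uniform dummy message *)

Section WiretapCode.
Context {R : realType} {N B M L : nat}.
Implicit Types (pa pb qa qb q d tau : R) (s : states B) (x y : word N B).
Implicit Types (F : 'I_M.+1 * 'I_L.+1 -> word N B).

(** Summing over [l] lets the weights add up when several indices share a codeword, so [F] may be
    any map. *)
Definition book_enc F (m : 'I_M.+1) x : R := \sum_l L.+1%:R^-1 * (x == F (m, l))%:R.

Lemma book_enc_ge0 F m x : 0 <= book_enc F m x.
Proof. by apply: sumr_ge0 => l _; rewrite mulr_ge0. Qed.

Lemma sum_book_enc F m (f : word N B -> R) :
  \sum_x book_enc F m x * f x = \sum_l L.+1%:R^-1 * f (F (m, l)).
Proof.
under eq_bigr do rewrite mulr_suml.
rewrite exchange_big; apply: eq_bigr => l _ /=.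
rewrite (bigD1 (F (m, l))) //= eqxx mulr1 big1 ?addr0 // => x /negPf ->.
by rewrite mulr0 mul0r.
Qed.

Lemma book_enc_sum1 F m : \sum_x book_enc F m x = 1.
Proof.
under eq_bigr do rewrite -[book_enc _ _ _]mulr1.
by rewrite (sum_book_enc F m (fun=> 1)) avg_cst.
Qed.

(* The randomness [l] is uniform; the legitimate receiver decodes it jointly
   with the message [m]. *)
Definition book_code pa pb tau F : @Defs.code R N B :=
  @Code R N B M.+1 isT (book_enc F) (book_enc_ge0 F) (book_enc_sum1 F)
    (fun s y => (thr_dec pa pb tau (ord0, ord0) F s y).1).

Lemma perr_book_code q pa pb tau F : 0 <= q <= 1 -> 0 <= pa <= 1 -> 0 <= pb <= 1 ->
  perr q pa pb (book_code pa pb tau F) <=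
  avg2 (fun m l => dec_err q pa pb tau (ord0, ord0) F (m, l)).
Proof.
move=> q01 a01 b01; rewrite -avg2_linear; apply: ler_sum => s _.
apply: ler_wpM2l; first exact: Pstate_ge0.
apply: ler_sum => m _ /=; rewrite ler_pM2l ?invr_gt0 //.
have -> : \sum_y Pout pa pb (book_code pa pb tau F) s m y *
     ((thr_dec pa pb tau (ord0, ord0) F s y).1 != m)%:R =
  \sum_y (\sum_l L.+1%:R^-1 * chan pa pb s (F (m, l)) y) *
     ((thr_dec pa pb tau (ord0, ord0) F s y).1 != m)%:R.
  apply: eq_bigr => y _; congr (_ * _).
  exact: (sum_book_enc F m (fun x => chan pa pb s x y)).
under [leLHS]eq_bigr do rewrite mulr_suml.
rewrite exchange_big; apply: ler_sum => l _ /=.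
rewrite mulr_sumr; apply: ler_sum => y _; rewrite -mulrA.
rewrite ler_pM2l ?invr_gt0 //; apply: ler_wpM2l; first exact: chan_ge0.
(* A wrong message makes the decoded pair wrong as well. *)
rewrite ler_nat; case: eqVneq => //= h; case: eqVneq => //= e.
by move: h; rewrite e eqxx.
Qed.

(* Given the message, the eavesdropper could decode [l]; so [l] uses up all of
   the information that the eavesdropper's channel can carry. *)
Lemma leak_book_code q pa pb qa qb tau tau' F :
  0 <= q <= 1 -> 0 <= qa <= 1 -> 0 <= qb <= 1 ->
  leak q qa qb (book_code pa pb tau F) <=
  (N * B)%:R * (1 - Havg q qa qb) + 1 -
  (1 - avg2 (fun m l => dec_err q qa qb tau' ord0 (fun l => F (m, l)) l)) * log2 L.+1%:R.
Proof.
move=> q01 a01 b01; rewrite leakE //; set C := book_code _ _ _ _.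
pose e s m l : R := \sum_y chan qa qb s (F (m, l)) y *
  (thr_dec qa qb tau' ord0 (fun l => F (m, l)) s y != l)%:R.
rewrite -avg2_linear.
apply: (@le_trans _ _ (\sum_(s : states B) Pstate q s * ((N * B)%:R -
   Hstate (N := N) qa qb s + 1 - (1 - avg2 (e s)) * log2 L.+1%:R))); last first.
  rewrite (eq_bigr (fun s => Pstate q s * ((N * B)%:R + 1 - log2 L.+1%:R) -
    Pstate q s * Hstate (N := N) qa qb s + Pstate q s * avg2 (e s) * log2 L.+1%:R)).
    rewrite big_split sumrB /= -!mulr_suml Pstate_sum1 Pstate_Hstate /Havg.
    by rewrite le_eqVlt; apply/orP; left; apply/eqP; ring.
  by move=> s _; ring.
apply: ler_sum => s _; apply: ler_wpM2l; first exact: Pstate_ge0.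
have PoutC m y : Pout qa qb C s m y =
    mix (fun=> L.+1%:R^-1) (fun l => chan qa qb s (F (m, l))) y.
  exact: (sum_book_enc F m (fun x => chan qa qb s x y)).
(* Fano's inequality for decoding [l] given [m], read as a lower bound on the output entropy given
   the message. *)
have eve (m : 'I_M.+1) : Hstate (N := N) qa qb s - 1 +
    (1 - \sum_l L.+1%:R^-1 * e s m l) * log2 L.+1%:R <= ent (Pout qa qb C s m).
  have := @fano R _ _ (fun l => chan qa qb s (F (m, l)))
    (thr_dec qa qb tau' ord0 (fun l => F (m, l)) s).
  rewrite card_ord => /(_ isT (fun l y => chan_ge0 _ _ _ _ _ a01 b01)
    (fun l => chan_sum1 _ _ _ _)).
  rewrite /info (eq_ent _ _ (fun y => esym (PoutC m y))).
  have -> : \sum_(l < L.+1) L.+1%:R^-1 * ent (chan qa qb s (F (m, l))) =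
      Hstate (N := N) qa qb s.
    rewrite (eq_bigr (fun=> L.+1%:R^-1 * Hstate (N := N) qa qb s)).
      exact: avg_cst.
    by move=> l _; rewrite ent_chan.
  have -> : \sum_(l < L.+1) L.+1%:R^-1 * (\sum_y chan qa qb s (F (m, l)) y *
      (thr_dec qa qb tau' ord0 (fun l => F (m, l)) s y == l)%:R) =
      1 - \sum_l L.+1%:R^-1 * e s m l.
    rewrite -[X in _ = X - _](@avg_cst R L) -sumrB; apply: eq_bigr => l _.
    rewrite -mulrBr; congr (_ * _).
    rewrite -[X in _ = X - _](chan_sum1 qa qb s (F (m, l))) -sumrB.
    apply: eq_bigr => y _; case: eqVneq => _ /=; by rewrite ?mulr1 ?mulr0 ?subr0 ?subrr.
  lra.
have mixle : ent (mix (unif C) (Pout qa qb C s)) <= (N * B)%:R.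
  apply: ent_word_le => [y|].
    apply: mix_ge0 => *; [exact: ltW (unif_gt0 _ _)|exact: Pout_ge0].
  rewrite exchange_big /= -[RHS](unif_sum1 C); apply: eq_bigr => m _.
  by rewrite -mulr_sumr Pout_sum1 mulr1.
have : \sum_m unif C m * (Hstate (N := N) qa qb s - 1 +
    (1 - \sum_l L.+1%:R^-1 * e s m l) * log2 L.+1%:R) <=
    \sum_m unif C m * ent (Pout qa qb C s m).
  by apply: ler_sum => m _; rewrite ler_pM2l ?unif_gt0.
rewrite (eq_bigr (fun m => unif C m * (Hstate (N := N) qa qb s - 1 + log2 L.+1%:R) -
  unif C m * (\sum_l L.+1%:R^-1 * e s m l) * log2 L.+1%:R)); last by move=> m _; ring.
rewrite sumrB -!mulr_suml unif_sum1 mul1r -/(avg2 (e s)) /info.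
lra.
Qed.

Lemma sum_others {J : finType} (i : J) (c : R) :
  \sum_(j | j != i) c = (#|J|%:R - 1) * c.
Proof.
have := @sumr_const R J predT c; rewrite (bigD1 i) //= -[RHS]mulr_natl => h.
by rewrite mulrBl mul1r -h addrAC subrr add0r.
Qed.

(** One codebook must serve both decoders: it is chosen for the sum of the two collision averages,
    and since both are nonnegative each is below the common bound. The atypicality bound holds for
    every codebook. *)
Lemma exists_codebook q pa pb qa qb d : (0 < N)%N -> (0 < B)%N -> 0 < d ->
  0 <= q <= 1 -> 0 <= pa <= 1 -> 0 <= pb <= 1 -> 0 <= qa <= 1 -> 0 <= qb <= 1 ->
  let t := threshold (N := N) (B := B) q pa pb d in
  let t' := threshold (N := N) (B := B) q qa qb d in
  let W := #|{: word N B}|%:R in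
  let eps : R := (cheb_const pa pb + cheb_const qa qb) / (B%:R * d ^+ 2) +
    ((M.+1 * L.+1)%:R - 1) * (W * t)^-1 + (L.+1%:R - 1) * (W * t')^-1 in
  exists F, (avg2 (fun m l => dec_err q pa pb t (ord0, ord0) F (m, l)) <= eps) /\
    (avg2 (fun m l => dec_err q qa qb t' ord0 (fun l => F (m, l)) l) <= eps).
Proof.
move=> N0 B0 d0 q01 a01 b01 qa01 qb01 t t' W eps.
pose g1 (F : {ffun 'I_M.+1 * 'I_L.+1 -> word N B}) m l : R :=
  \sum_(j | j != (m, l)) collision q pa pb t (F (m, l)) (F j).
pose g2 (F : {ffun 'I_M.+1 * 'I_L.+1 -> word N B}) m l : R :=
  \sum_(l' | l' != l) collision q qa qb t' (F (m, l)) (F (m, l')).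
have t0 : 0 < t by rewrite powR_gt0.
have t'0 : 0 < t' by rewrite powR_gt0.
have coll0 (p1 p2 : R) tau x x' : 0 <= p1 <= 1 -> 0 <= p2 <= 1 -> 0 <= collision q p1 p2 tau x x'.
  move=> h1 h2; apply: sumr_ge0 => s _; rewrite mulr_ge0 ?Pstate_ge0 //.
  by apply: sumr_ge0 => y _; rewrite mulr_ge0 ?chan_ge0.
have [F gF] : exists F : {ffun 'I_M.+1 * 'I_L.+1 -> word N B}, avg2 (fun m l => g1 F m l + g2 F m l) <=
    ((M.+1 * L.+1)%:R - 1) * (W * t)^-1 + (L.+1%:R - 1) * (W * t')^-1.
  apply: (@exists_le_expect R N B ('I_M.+1 * 'I_L.+1)%type
    (fun F : {ffun _ -> _} => avg2 (fun m l => g1 F m l + g2 F m l))).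
  rewrite avg2_linear -[leRHS](@avg2_cst R M L); apply: avg2_le => m l.
  under eq_bigr do rewrite mulrDr; rewrite big_split /=; apply: lerD.
    under eq_bigr do rewrite mulr_sumr; rewrite exchange_big /=.
    have -> : (M.+1 * L.+1)%N = #|{: 'I_M.+1 * 'I_L.+1}| by rewrite card_prod !card_ord.
    rewrite -(sum_others (m, l)); apply: ler_sum => j ij.
    by apply: expect_collision => //; rewrite eq_sym.
  under eq_bigr do rewrite mulr_sumr; rewrite exchange_big /=.
  rewrite -[X in X%:R - 1](card_ord L.+1) -(sum_others l); apply: ler_sum => l' ll'.
  by apply: expect_collision => //; rewrite xpair_eqE eqxx eq_sym.
have k0 : 0 < B%:R * d ^+ 2 by rewrite mulr_gt0 ?exprn_gt0 ?ltr0n.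
have g10 : 0 <= avg2 (g1 F).
  by apply: avg2_ge0 => m l; apply: sumr_ge0 => j _; exact: coll0.
have g20 : 0 <= avg2 (g2 F).
  by apply: avg2_ge0 => m l; apply: sumr_ge0 => j _; exact: coll0.
have c1 := divr_ge0 (cheb_const_ge0 _ _ a01 b01) (ltW k0).
have c2 := divr_ge0 (cheb_const_ge0 _ _ qa01 qb01) (ltW k0).
move: gF; rewrite avg2D => gF; exists F; split.
  apply: (@le_trans _ _ (avg2 (fun m l => cheb_const pa pb / (B%:R * d ^+ 2) + g1 F m l))).
    apply: avg2_le => m l; apply: (le_trans (dec_err_le _ _ _ _ _ _ _ q01 a01 b01)).
    by rewrite lerD2r; exact: atypical_le.
  by rewrite avg2D avg2_cst /eps mulrDl; lra.
apply: (@le_trans _ _ (avg2 (fun m l => cheb_const qa qb / (B%:R * d ^+ 2) + g2 F m l))).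
  apply: avg2_le => m l; apply: (le_trans (dec_err_le _ _ _ _ _ _ _ q01 qa01 qb01)).
  by rewrite lerD2r; exact: atypical_le.
by rewrite avg2D avg2_cst /eps mulrDl; lra.
Qed.

End WiretapCode.

(** * Achievability *)

Section Achievability.
Context {R : realType}.
Implicit Types (x y d e : R).

Lemma pow2D x y : 2 `^ (x + y) = 2 `^ x * 2 `^ y :> R.
Proof. by rewrite powRD // pnatr_eq0 implybT. Qed.

Lemma pow2_le x y : x <= y -> 2 `^ x <= 2 `^ y :> R.
Proof. by move=> xy; rewrite ler_powR // ler1n. Qed.

(** Trades exponential decay for an inverse-linear bound, so that a sufficient block size can be
    written down explicitly. *)
Lemma pow2N_le x : 0 < x -> 2 `^ (- x) <= (x * ln 2)^-1 :> R.
Proof.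
move=> x0; have l2 := @ln2_gt0 R.
rewrite powRN lef_pV2 ?posrE ?powR_gt0 ?mulr_gt0 //.
rewrite /powR pnatr_eq0 /=; apply: le_trans (expR_ge1Dx _).
by rewrite lerDr ler01.
Qed.

(** For an index set of this size, the first bound guarantees the rate, and the second limits the
    number of wrong competitors, one less than the size. *)
Lemma truncnS_bounds x : 0 <= x ->
  x <= (Num.truncn x).+1%:R /\ (Num.truncn x).+1%:R - 1 <= x.
Proof.
move=> x0; split; first exact/ltW/truncnS_gt.
by rewrite -addn1 natrD addrK truncn_le.
Qed.

Lemma Hb0 : Hb 0 = 0 :> R.
Proof. by rewrite /Hb !xlog2xE subr0 log2_1; ring. Qed.

Lemma Hb_ge0 x : 0 <= x -> x <= 2^-1 -> 0 <= Hb x.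
Proof. by move=> x0 x2; rewrite -Hb0 Hb_le. Qed.

(* With [h], [h'] the conditional entropies of the two channels, the message
   rate is [h' - h - 2 d] and the rate of the randomness is [1 - h' - 2 d]. *)
Lemma collision_bound (n h h' d : R) (M L : nat) :
  0 <= n -> 0 < d -> h <= h' -> h' <= 1 ->
  M.+1%:R - 1 <= 2 `^ (n * (h' - h - 2 * d)) ->
  L.+1%:R - 1 <= 2 `^ (n * (1 - h' - 2 * d)) ->
  ((M.+1 * L.+1)%:R - 1) * (2 `^ n * 2 `^ (- (n * (h + d))))^-1 +
  (L.+1%:R - 1) * (2 `^ n * 2 `^ (- (n * (h' + d))))^-1 <= 4 * 2 `^ (- (n * d)).
Proof.
move=> n0 d0 hh' h'1; set x := 2 `^ _; set y := 2 `^ (n * (1 - _ - _)) => Mx Ly.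
have M0 : 0 <= M.+1%:R - 1 :> R by rewrite subr_ge0 ler1n.
have L0 : 0 <= L.+1%:R - 1 :> R by rewrite subr_ge0 ler1n.
have x0 : 0 <= x by rewrite powR_ge0.
have y0 : 0 <= y by rewrite powR_ge0.
rewrite -!pow2D -!powRN.
set u := 2 `^ (- (n + _)); set v := 2 `^ (- (n + _)).
have u0 : 0 <= u by rewrite powR_ge0.
have v0 : 0 <= v by rewrite powR_ge0.
(* A wrong pair differs in both indices, only in the message, or only in the dummy index. *)
have ML : (M.+1 * L.+1)%:R - 1 <= x * y + x + y :> R.
  have := ler_pM M0 L0 Mx Ly; rewrite natrM; lra.
have nd : 0 <= n * d by rewrite mulr_ge0 // ltW.
have nh : 0 <= n * (h' - h) by rewrite mulr_ge0 // subr_ge0.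
have n1 : 0 <= n * (1 - h') by rewrite mulr_ge0 // subr_ge0.
(* In each of the four products the exponents add up to at most [- (n * d)]; the product [y * v]
   attains this value. *)
have xyu : x * y * u <= 2 `^ (- (n * d)).
  by rewrite /x /y /u -!pow2D; apply: pow2_le; nra.
have xu : x * u <= 2 `^ (- (n * d)).
  by rewrite /x /u -!pow2D; apply: pow2_le; nra.
have yu : y * u <= 2 `^ (- (n * d)).
  by rewrite /y /u -!pow2D; apply: pow2_le; nra.
have yv : y * v <= 2 `^ (- (n * d)).
  by rewrite /y /v -!pow2D; apply: pow2_le; nra.
have := ler_wpM2r u0 ML; have := ler_wpM2r v0 Ly; lra.
Qed.

(** Square arrays, with [N = B = k], let one parameter control both the block length and the number
    of blocks. *)
Lemma good_code (q p1 p2 ps1 ps2 e : R) (K : nat) : 0 <= q <= 1 ->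
  0 <= p1 -> p1 <= ps1 -> ps1 <= 2^-1 -> 0 <= p2 -> p2 <= ps2 -> ps2 <= 2^-1 ->
  0 < e <= 1 ->
  exists (k : nat) (C : Defs.code k k), [/\ (K <= k)%N,
    q * (Hb ps1 - Hb p1) + (1 - q) * (Hb ps2 - Hb p2) - e <= rate C,
    perr q p1 p2 C <= e & leak q ps1 ps2 C / (k * k)%:R <= e].
Proof.
move=> q01 p10 p1s s1 p20 p2s s2 /andP[e0 e1].
have a01 : 0 <= p1 <= 1 by lra.
have b01 : 0 <= p2 <= 1 by lra.
have qa01 : 0 <= ps1 <= 1 by lra.
have qb01 : 0 <= ps2 <= 1 by lra.
(* The rate loses [2 * d], and the normalized leakage will be at most [3 * d]. *)
pose d := e / 4; have d0 : 0 < d by rewrite divr_gt0.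
have l2 := @ln2_gt0 R.
(* The three terms account for atypicality, collisions and the [n^-1] of Fano's inequality, so that
   [eps + n^-1 <= D / k]. *)
pose D := (cheb_const p1 p2 + cheb_const ps1 ps2) / d ^+ 2 + 4 / (d * ln 2) + 1.
have D1 : 1 <= D.
  rewrite lerDr addr_ge0 // divr_ge0 ?sqr_ge0 ?addr_ge0 ?cheb_const_ge0 //.
  by rewrite mulr_ge0 // ltW.
pose k := maxn K.+1 (Num.truncn (D / d)).+1.
have k0 : (0 < k)%N by rewrite /k leq_max.
have kr1 : 1 <= k%:R :> R by rewrite ler1n.
have kr0 : 0 < k%:R :> R by rewrite ltr0n.
have Dk : D / k%:R <= d.
  rewrite ler_pdivrMr // mulrC -ler_pdivrMr //; apply: (@le_trans _ _ (Num.truncn (D / d)).+1%:R).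
    exact/ltW/truncnS_gt.
  by rewrite ler_nat leq_maxr.
pose n : R := (k * k)%:R.
have n0 : 0 < n by rewrite ltr0n muln_gt0 k0.
have nk : k%:R <= n by rewrite ler_nat leq_pmulr.
pose h := Havg q p1 p2; pose h' := Havg q ps1 ps2.
have q0 : 0 <= q by lra.
have q1 : 0 <= 1 - q by lra.
have h0 : 0 <= h.
  have := mulr_ge0 q0 (Hb_ge0 _ p10 (le_trans p1s s1)).
  have := mulr_ge0 q1 (Hb_ge0 _ p20 (le_trans p2s s2)).
  rewrite /h /Havg; lra.
have hh' : h <= h'.
  have := ler_wpM2l q0 (Hb_le _ _ p10 p1s s1).
  have := ler_wpM2l q1 (Hb_le _ _ p20 p2s s2).
  rewrite /h /h' /Havg; lra.
have h'1 : h' <= 1.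
  have := ler_wpM2l q0 (Hb_le1 _ qa01).
  have := ler_wpM2l q1 (Hb_le1 _ qb01).
  rewrite /h' /Havg; lra.
(* A negative exponent is harmless: the truncation is then 0, the set has one element, and both
   bounds still hold. *)
have [xM Mx] := truncnS_bounds _ (powR_ge0 2 (n * (h' - h - 2 * d))).
have [yL Ly] := truncnS_bounds _ (powR_ge0 2 (n * (1 - h' - 2 * d))).
set M := Num.truncn _ in xM Mx; set L := Num.truncn _ in yL Ly.
have [F [errB errE]] := @exists_codebook R k k M L q p1 p2 ps1 ps2 d
  k0 k0 d0 q01 a01 b01 qa01 qb01.
set t := threshold _ _ _ _ in errB errE; set t' := threshold _ _ _ _ in errB errE.
have W2 : #|{: word k k}|%:R = 2 `^ n :> R by rewrite card_word natrX -powR_mulrn.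
set eps := (X in _ <= X) in errB; rewrite -[X in _ <= X]/eps in errE.
have epsD : eps + n^-1 <= d.
  apply: le_trans Dk; rewrite /eps W2.
  have := collision_bound n h h' d M L (ltW n0) d0 hh' h'1 Mx Ly.
  have := pow2N_le _ (mulr_gt0 n0 d0).
  rewrite -/t -/t' /D => A.
  have nV : n^-1 <= k%:R^-1 by rewrite lef_pV2 ?posrE.
  have A' : (n * d * ln 2)^-1 <= (d * ln 2)^-1 / k%:R.
    rewrite -mulrA invfM mulrC ler_pM2l // invr_gt0 mulr_gt0 //.
  have -> : ((cheb_const p1 p2 + cheb_const ps1 ps2) / d ^+ 2 + 4 / (d * ln 2) + 1) / k%:R =
    (cheb_const p1 p2 + cheb_const ps1 ps2) / (k%:R * d ^+ 2) +
    4 * ((d * ln 2)^-1 / k%:R) + k%:R^-1.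
    by field; rewrite !gt_eqF.
  by move=> T; lra.
have nV0 : 0 < n^-1 by rewrite invr_gt0.
exists k, (book_code p1 p2 t F); split.
- by rewrite (leq_trans (leqnSn K)) // leq_maxl.
- rewrite /rate /= ler_pdivlMr //.
  have := ler_log2 _ _ (powR_gt0 _ _) xM; rewrite log2_pow2 => /(_ (ltr0n _ 2)).
  apply: le_trans; rewrite mulrC ler_pM2l // /h /h' /Havg /d; lra.
- apply: (le_trans (perr_book_code _ _ _ _ _ q01 a01 b01)); apply: (le_trans errB).
  rewrite /d in epsD; lra.
rewrite ler_pdivrMr //.
apply: (le_trans (leak_book_code _ p1 p2 _ _ t t' F q01 qa01 qb01)).
have E0 : 0 <= avg2 (fun m l => dec_err q ps1 ps2 t' ord0 (fun l => F (m, l)) l).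
  by apply: avg2_ge0 => m l; exact: dec_err_ge0.
move: errE E0; set E := avg2 _ => errE E0.
have := ler_log2 _ _ (powR_gt0 _ (ltr0n _ 2)) yL; rewrite log2_pow2 => logL.
have E1 : 0 <= 1 - E by rewrite /d in epsD; lra.
have := ler_wpM2l E1 logL.
suff : n * (1 - h') + 1 - (1 - E) * (n * (1 - h' - 2 * d)) <= e * n.
  rewrite -/n -/h'; lra.
have -> : n * (1 - h') + 1 - (1 - E) * (n * (1 - h' - 2 * d)) =
  (n^-1 + E * (1 - h') + 2 * d * (1 - E)) * n by field; rewrite gt_eqF.
rewrite ler_pM2r //.
have : E * (1 - h') <= E by rewrite ler_piMr //; lra.
have : d * (1 - E) <= d by rewrite ler_piMr // ?(ltW d0) //; lra.
rewrite /d in epsD *; lra.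
Qed.

(** Codes from [good_code] with slack [1 / (t + 1)] and size at least [t], chosen for each [t], form
    a single sequence meeting all the limits. *)
Lemma capacity_achievable (q p1 p2 ps1 ps2 : R) : 0 <= q <= 1 ->
  0 <= p1 -> p1 <= ps1 -> ps1 <= 2^-1 -> 0 <= p2 -> p2 <= ps2 -> ps2 <= 2^-1 ->
  achievable q p1 p2 ps1 ps2 (q * (Hb ps1 - Hb p1) + (1 - q) * (Hb ps2 - Hb p2)).
Proof.
move=> q01 p10 p1s s1 p20 p2s s2.
have a01 : 0 <= p1 <= 1 by lra.
have b01 : 0 <= p2 <= 1 by lra.
have qa01 : 0 <= ps1 <= 1 by lra.
have qb01 : 0 <= ps2 <= 1 by lra.
have inv01 (t : nat) : 0 < (t.+1%:R^-1 : R) <= 1.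
  by rewrite invr_gt0 ltr0n /= invf_le1 ?ltr0n // ler1n.
have code_t (t : nat) : {k : nat & {C : Defs.code k k | [/\ (t <= k)%N,
    q * (Hb ps1 - Hb p1) + (1 - q) * (Hb ps2 - Hb p2) - t.+1%:R^-1 <= rate C,
    perr q p1 p2 C <= t.+1%:R^-1 & leak q ps1 ps2 C / (k * k)%:R <= t.+1%:R^-1]}}.
  have := good_code q p1 p2 ps1 ps2 _ t q01 p10 p1s s1 p20 p2s s2 (inv01 t).
  by move=> /cid[k /cid[C ?]]; exists k, C.
pose k t := projT1 (code_t t); pose C t := projT1 (projT2 (code_t t)).
have spec t := projT2 (projT2 (code_t t)); rewrite -/(k _) -/(C _) in spec.
have small (e : R) : 0 < e -> \forall t \near \oo, t.+1%:R^-1 <= e.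
  move=> e0; have /cvgr0Pnorm_le/(_ e e0) := @cvg_harmonic R.
  by apply: filterS => t; rewrite ger0_norm // /harmonic /= invr_ge0.
exists k, k, C; split; [|split; [|split]].
- move=> K; exists K => // t /= Kt; have [tk _ _ _] := spec t.
  by split; exact: leq_trans Kt tk.
- move=> e /small; apply: filterS => t te; have [_ + _ _] := spec t.
  by move=> h; apply: le_trans h; rewrite lerD2l lerN2.
- apply/cvgr0Pnorm_le => e /small; apply: filterS => t te.
  have [_ _ + _] := spec t.
  by rewrite ger0_norm ?perr_ge0 // => /le_trans; apply.
- apply/cvgr0Pnorm_le => e /small; apply: filterS => t te.
  have [_ _ _ +] := spec t.
  rewrite ger0_norm; first by move=> /le_trans; apply.
  rewrite divr_ge0 // leakE //; apply: sumr_ge0 => s _.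
  rewrite mulr_ge0 ?Pstate_ge0 // info_ge0 // => [m|m y|m|].
  - exact: ltW (unif_gt0 _ _).
  - exact: Pout_ge0.
  - exact: Pout_sum1.
  - exact: unif_sum1.
Qed.

End Achievability.

Theorem theorem1 (R : realType) (q1 p1 p2 ps1 ps2 : R) :
  0 <= q1 <= 1 ->
  0 <= p1 -> p1 <= p2 -> p2 <= ps1 -> ps1 <= ps2 -> ps2 <= 2^-1 ->
  secrecy_capacity_CSID q1 p1 p2 ps1 ps2 =
    (q1 * (Hb ps1 - Hb p1) + (1 - q1) * (Hb ps2 - Hb p2))%:E.
Proof.
move=> q01 p10 p12 p2s s12 s2.
have p1s : p1 <= ps1 by exact: le_trans p2s.
have s1 : ps1 <= 2^-1 by exact: le_trans s2.
have p20 : 0 <= p2 by exact: le_trans p12.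
have p2s2 : p2 <= ps2 by exact: le_trans s12.
apply/le_anti/andP; split.
  apply: ge_ereal_sup => _ [r /= ach <-]; rewrite lee_fin.
  exact: achievable_le ach.
(* The supremum is attained, since achievability asks for the rate only up to a vanishing slack. *)
apply: ereal_sup_ubound; eexists; last reflexivity.
exact: capacity_achievable.
Qed.
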